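(* Let $G$ be a connected Lie group with Lie algebra $\mathfrak{g}$, let $\Gamma$ be a left-invariant second-order differential equation field on $TG$, and let $\gamma$ be the corresponding reduced vector field on $\mathfrak{g}$. Then $\Gamma$ admits a regular left-invariant Lagrangian $L$ on $TG$ (i.e. $\Gamma$ is the Euler-Lagrange field of some left-invariant regular $L\in C^\infty(TG)$) if and only if $\gamma$ admits a regular Lagrangian on $\mathfrak{g}$, in the sense that there is a smooth function $l$ on $\mathfrak{g}$ whose Hessian is (everywhere) non-singular, such that $\gamma$ is the vector field uniquely determined by the Euler-Poincaré equations of $l$: $$\gamma\left(\frac{\partial l}{\partial w^i}\right)=C^j_{ki}\,w^k\,\frac{\partial l}{\partial w^j}\qquad\text{for all } i.$$
   Context: All objects are smooth; summation convention is used. $(q^i,\dot q^i)$ are coordinates on $TG$ induced by local coordinates $(q^i)$ on $G$. For a vector field $X=X^i(q)\,\partial/\partial q^i$ on $G$, the vertical lift is $X^{V}=X^i\,\partial/\partial\dot q^i$ and the complete lift is $X^{C}=X^i\,\partial/\partial q^i+\frac{\partial X^i}{\partial q^j}\dot q^j\,\partial/\partial\dot q^i$, vector fields on $TG$. A second-order differential equation field is a vector field on $TG$ of the form $\Gamma=\dot q^i\,\partial/\partial q^i+f^i(q,\dot q)\,\partial/\partial\dot q^i$. Left-invariance of functions and vector fields on $TG$ means invariance under the diffeomorphisms $T\lambda_h$ for all $h\in G$, $\lambda_h$ being left multiplication. A Lagrangian $L\in C^\infty(TG)$ is regular if $(\partial^2L/\partial\dot q^i\partial\dot q^j)$ is everywhere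 non-singular; its Euler-Lagrange field is the unique second-order differential equation field $\Gamma$ with $\Gamma(X^{V}(L))=X^{C}(L)$ for all vector fields $X$ on $G$. Fix a basis $\{E_i\}$ of $\mathfrak{g}=T_eG$, let $\hat E_i$ be the left-invariant vector field with $\hat E_i(e)=E_i$, and let $[\hat E_i,\hat E_j]=C_{ij}^k\hat E_k$. Let $w^i$ be the functions on $TG$ with $v=w^i(v)\hat E_i(\tau(v))$ for $v\in TG$, where $\tau:TG\to G$; restricted to $T_eG=\mathfrak{g}$ they are the linear coordinates with respect to $\{E_i\}$. Reduced vector field: a left-invariant second-order differential equation field can be written $\Gamma=w^i\hat E_i^{C}+\Gamma^i\hat E_i^{V}$ with left-invariant functions $\Gamma^i$ on $TG$; with $\gamma^i=\Gamma^i|_{T_eG}\in C^\infty(\mathfrak{g})$, the reduced vector field is $\gamma=\gamma^i\,\partial/\partial w^i$ on $\mathfrak{g}$. *)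

(* Defs.v *)
From HB Require Import structures.
From mathcomp Require Import all_boot all_order all_algebra.
From mathcomp Require Import all_classical all_reals all_analysis.

Set Implicit Arguments.
Unset Strict Implicit.
Unset Printing Implicit Defensive.

Import Order.TTheory GRing.Theory Num.Theory.
Import numFieldNormedType.Exports.

Local Open Scope classical_set_scope.
Local Open Scope ring_scope.

(** * Smooth maps between finite-dimensional normed spaces *)

(** Only values of [f] near points of [U] matter when [U] is open.  In finite
    dimension, requiring every directional derivative ['D_v f] (constant [v])
    to be of class C^k is the same as asking it of the partial derivatives. *)
Fixpoint classC {R : realType} {V W : normedModType R} (k : nat)
    (U : set V) (f : V -> W) : Prop :=
  match k with
  | 0 => forall x, U x -> {for x, continuous f}
  | k'.+1 => (forall x, U x -> differentiable f x) /\
             (forall v : V, classC k' U ('D_v f))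
  end.

Definition smooth_on {R : realType} {V W : normedModType R}
    (U : set V) (f : V -> W) : Prop := forall k, classC k U f.

(** * Atlases and tangent bundles *)

(** [param c] is the inverse of [chart c]; both are total functions, relevant
    only on [dom c] and on its image.  [chart_at p] is a preferred chart around
    [p]. *)
Record atlas (M : Type) (V : Type) := Atlas {
  index : Type;
  dom : index -> set M;
  chart : index -> M -> V;
  param : index -> V -> M;
  chart_at : M -> index }.

Definition cod M V (A : atlas M V) (c : index A) : set V :=
  chart c @` dom c.

Record smooth_manifold {R : realType} {V : normedModType R}
    (M : topologicalType) (A : atlas M V) : Prop := SmoothManifold {
  manifold_hausdorff : hausdorff_space M;
  manifold_second_countable : @second_countable M;
  chart_at_dom : forall p, dom (chart_at A p) p;
  dom_open : forall c : index A, open (dom c);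
  cod_open : forall c : index A, open (cod c);
  chartK : forall (c : index A) p, dom c p -> param c (chart c p) = p;
  chart_continuous : forall (c : index A) p,
    dom c p -> {for p, continuous (chart c)};
  param_continuous : forall (c : index A) x,
    cod c x -> {for x, continuous (@param _ _ A c)};
  transition_smooth : forall c d : index A,
    smooth_on (cod c `&` (param c @^-1` dom d)) (chart d \o param c) }.

Definition prod_atlas M N V W (A : atlas M V) (B : atlas N W) :
    atlas (M * N) (V * W) :=
  {| index := index A * index B;
     dom := fun c => [set p | dom c.1 p.1 /\ dom c.2 p.2];
     chart := fun c p => (chart c.1 p.1, chart c.2 p.2);
     param := fun c x => (param c.1 x.1, param c.2 x.2);
     chart_at := fun p => (chart_at A p.1, chart_at B p.2) |}.

Definition smooth_map {R : realType} {V W : normedModType R}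
    (M N : topologicalType) (A : atlas M V) (B : atlas N W) (f : M -> N) : Prop :=
  continuous f /\
  forall (c : index A) (d : index B),
    smooth_on (cod c `&` (param c @^-1` (f @^-1` dom d)))
              (chart d \o f \o param c).

Definition smooth_fun {R : realType} {V : normedModType R} M (A : atlas M V)
    (F : M -> R) : Prop :=
  forall c : index A, smooth_on (cod c) (F \o param c : V -> R^o).

(** A tangent vector at [p] is encoded by its components in the preferred chart
    [chart_at p].  Thus every tangent space is a copy of [V], the underlying
    type of the tangent bundle is [M * V], and a vector field is a function
    [X : M -> V].  [components c p u] are the components of the vector [(p, u)]
    in another chart [c]; [vector_of c x y] is the vector at [param c x] whose
    components in [c] are [y]. *)
Section TangentBundle.
Context {R : realType} {V : normedModType R} {M : Type} (A : atlas M V).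
Implicit Types (c : index A) (p : M) (u y x : V).

Definition components c p u : V :=
  'D_u (chart c \o param (chart_at A p)) (chart (chart_at A p) p).

Definition vector_of c x y : V :=
  'D_y (chart (chart_at A (param c x)) \o param c) x.

(** The charts are those of the induced coordinates (q, qdot).  The topology
    of the tangent bundle is not the product topology of [M * V], and it is
    never used: smoothness on it is always tested in charts. *)
Definition tangent_atlas : atlas (M * V) (V * V) :=
  {| index := index A;
     dom := fun c => [set v | dom c v.1];
     chart := fun c v => (chart c v.1, components c v.1 v.2);
     param := fun c z => (param c z.1, vector_of c z.1 z.2);
     chart_at := fun v => chart_at A v.1 |}.

Definition smooth_field (X : M -> V) : Prop :=
  forall c, smooth_on (cod c) (fun x => components c (param c x) (X (param c x))).

(** [X(F)] *)
Definition field_apply (X : M -> V) (F : M -> R) : M -> R := fun p =>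
  'D_(X p) (F \o param (chart_at A p) : V -> R^o) (chart (chart_at A p) p).

(** [[X, Y]^i = X^j dY^i/dq^j - Y^j dX^i/dq^j], in the preferred chart *)
Definition bracket (X Y : M -> V) : M -> V := fun p =>
  let c := chart_at A p in
  let loc (Z : M -> V) := fun x => components c (param c x) (Z (param c x)) in
  'D_(X p) (loc Y) (chart c p) - 'D_(Y p) (loc X) (chart c p).

(** The lifts are given by their coordinate expressions in the chart of the
    tangent bundle induced by the preferred chart. *)
Definition vertical_lift (X : M -> V) : M * V -> V * V := fun v => (0, X v.1).

Definition complete_lift (X : M -> V) : M * V -> V * V := fun v =>
  let c := chart_at A v.1 in
  (X v.1,
   'D_(v.2) (fun x => components c (param c x) (X (param c x))) (chart c v.1)).

End TangentBundle.

Definition tangent_map {R : realType} {V W : normedModType R} M N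
    (A : atlas M V) (B : atlas N W) (f : M -> N) (v : M * V) : N * W :=
  (f v.1,
   'D_(v.2) (chart (chart_at B (f v.1)) \o f \o param (chart_at A v.1))
            (chart (chart_at A v.1) v.1)).

(** In every induced chart the field reads
    [qdot^i d/dq^i + f^i(q, qdot) d/dqdot^i]. *)
Definition second_order_field {R : realType} {V : normedModType R} M
    (A : atlas M V) (Z : M * V -> V * V) : Prop :=
  smooth_field (tangent_atlas A) Z /\
  forall (c : index (tangent_atlas A)) (v : M * V), dom c v ->
    (components c v (Z v)).1 = (chart c v).2.

(** * Lagrangians *)

Definition regular_lagrangian {R : realType} {n : nat} M
    (A : atlas M 'rV[R]_n) (L : M * 'rV[R]_n -> R) : Prop :=
  let e i : 'rV[R]_n * 'rV[R]_n := (0, delta_mx 0 i) in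
  forall (c : index (tangent_atlas A)) (v : M * 'rV[R]_n), dom c v ->
    (\matrix_(i < n, j < n)
       'D_(e i) ('D_(e j) (L \o param c : _ -> R^o)) (chart c v))
      \in unitmx.

(** For a regular [L] such a field is unique. *)
Definition euler_lagrange_field {R : realType} {V : normedModType R} M
    (A : atlas M V) (L : M * V -> R) (Z : M * V -> V * V) : Prop :=
  second_order_field A Z /\
  forall X : M -> V, smooth_field A X -> forall v : M * V,
    field_apply (tangent_atlas A) Z
      (field_apply (tangent_atlas A) (vertical_lift X) L) v
    = field_apply (tangent_atlas A) (complete_lift A X) L v.

(** * Lie groups *)

#[short(type="groupTopologicalType")]
HB.structure Definition GroupTopological := {G of Group G & Topological G}.

Definition lie_group {R : realType} {n : nat} (G : groupTopologicalType)
    (A : atlas G 'rV[R]_n) : Prop :=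
  [/\ smooth_manifold A,
      smooth_map (prod_atlas A A) A (fun p : G * G => (p.1 * p.2)%g) &
      smooth_map A A (fun p : G => (p^-1)%g)].

(** The Lie algebra is the tangent space at [1], hence the type ['rV_n]; a
    basis [E] of it is arbitrary. *)
Section LieGroup.
Context {R : realType} {n : nat} {G : groupTopologicalType}.
Context (A : atlas G 'rV[R]_n).
Local Notation V := 'rV[R]_n.

Definition ltrans (h : G) : G * V -> G * V :=
  tangent_map A A (fun p : G => (h * p)%g).

Definition left_invariant_fun (F : G * V -> R) : Prop :=
  forall h v, F (ltrans h v) = F v.

Definition left_invariant_field (Z : G * V -> V * V) : Prop :=
  forall h v,
    tangent_map (tangent_atlas A) (tangent_atlas A) (ltrans h) (v, Z v)
    = (ltrans h v, Z (ltrans h v)).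

(** the left-invariant vector field on [G] with value [u] at [1] *)
Definition left_field (u : V) : G -> V := fun p => (ltrans p (1%g, u)).2.

Definition left_frame (E : n.-tuple V) (p : G) : n.-tuple V :=
  [tuple left_field (tnth E i) p | i < n].

(** [w^i] *)
Definition frame_coord (E : n.-tuple V) (i : 'I_n) (v : G * V) : R :=
  coord (left_frame E v.1) i v.2.

(** [C i j k] is [C_{ij}^k]. *)
Definition structure_constants (E : n.-tuple V) (C : 'I_n -> 'I_n -> 'I_n -> R)
    : Prop :=
  forall i j p,
    bracket A (left_field (tnth E i)) (left_field (tnth E j)) p
    = \sum_(k < n) C i j k *: left_field (tnth E k) p.

(** The coefficients [Gi] are determined by [Z]; they are smooth and
    left-invariant when [Z] is. *)
Definition reduced_field (E : n.-tuple V) (Z : G * V -> V * V) (gamma : V -> V)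
    : Prop :=
  exists Gi : 'I_n -> G * V -> R,
    (forall v, Z v =
       \sum_(i < n) frame_coord E i v *: complete_lift A (left_field (tnth E i)) v
       + \sum_(i < n) Gi i v *: vertical_lift (left_field (tnth E i)) v) /\
    (forall u, gamma u = \sum_(i < n) Gi i (1%g, u) *: tnth E i).

End LieGroup.

(** * Lagrangians on the Lie algebra *)

(** [d/dw^i] is the derivative in the direction of the i-th basis vector. *)
Definition regular_on_algebra {R : realType} {n : nat}
    (E : n.-tuple 'rV[R]_n) (l : 'rV[R]_n -> R) : Prop :=
  forall u : 'rV[R]_n,
    (\matrix_(i < n, j < n)
       'D_(tnth E i) ('D_(tnth E j) (l : 'rV[R]_n -> R^o)) u) \in unitmx.

(** For a regular [l] such a field is unique. *)
Definition euler_poincare_field {R : realType} {n : nat}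
    (E : n.-tuple 'rV[R]_n) (C : 'I_n -> 'I_n -> 'I_n -> R)
    (l : 'rV[R]_n -> R) (gamma : 'rV[R]_n -> 'rV[R]_n) : Prop :=
  forall (i : 'I_n) (u : 'rV[R]_n),
    'D_(gamma u) ('D_(tnth E i) (l : 'rV[R]_n -> R^o)) u
    = \sum_(j < n) \sum_(k < n)
        C k i j * coord E k u * 'D_(tnth E j) (l : 'rV[R]_n -> R^o) u.

(* Main.v *)
(** The left Maurer-Cartan form [theta : TG -> g] identifies left-invariant
    functions on [TG] with functions on [g], through [L = l \o theta].  In
    induced coordinates [theta (x, y)] is linear in [y], so that the Hessian of
    [L] along the fibres is congruent to that of [l]; and [theta] maps [Gamma]
    to [gamma], because the complete lifts of the frame contribute
    [dtheta(y, y) - dtheta(y, y) = 0].  Writing [xi = theta X] and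
    [w = theta v], the Euler-Lagrange equation for [X] at [v] becomes
    [gamma (D_xi l) (w) = D_b l (w)], where [b] is the value of the exterior
    derivative of [theta] on [(X, v)] and equals [[w, xi]] by the Maurer-Cartan
    equation. *)
From HB Require Import structures.
Require Import Defs.
From mathcomp Require Import all_boot all_order all_algebra.
From mathcomp Require Import all_classical all_reals all_analysis.
Set Implicit Arguments.
Unset Strict Implicit.
Unset Printing Implicit Defensive.
Import Order.TTheory GRing.Theory Num.Theory.
Import numFieldNormedType.Exports.
Local Open Scope classical_set_scope.
Local Open Scope ring_scope.

(** A vector at [p] is stored by its components in [chart_at A p], and nothing controls how this
    preferred chart varies with [p]; so neither [theta] nor a left-invariant field is visibly
    smooth. Both are therefore rewritten in a fixed chart as partial derivatives of group
    operations: [theta] as the derivative of p^-1 q in [q] on the diagonal, a left-invariant field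
    as the derivative of p q in [q] at the identity. What follows is calculus on open subsets of
    [V].

    The exterior derivative of [theta] is never formed. Its ingredient [dtheta_chart] is bilinear in
    the values of two vectors, whereas [bracket] is defined on fields; the alternation of the former
    is identified with the latter on left-invariant fields, which by bilinearity settles all pairs
    of vectors. For an arbitrary field [X] the derivatives of [X] cancel between the two sides of
    the Euler-Lagrange equation, so that only [X p] matters and the frame suffices as a test. *)

Section Differentiation.
Context {R : realType}.
Implicit Types V W : normedModType R.

(** * Differentiation rules and stability properties of the class C^k *)

Lemma near_eq_differentiable V W (f g : V -> W) x :
  (\near x, f x = g x) -> differentiable f x -> differentiable g x.
Proof.
move=> fg /diff_locallyP[dc df].
have E : g \o shift x = cst (g x) + 'd f x +o_ 0 id.
  apply/eqaddoP => e e0; move/eqaddoP: df => /(_ e e0); apply: filter_app.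
  move: (fg); rewrite (near_shift 0) subr0 => {}fg0.
  apply: filterS fg0 => h /= H.
  rewrite /= -![(_ - _) _]/(_ - _) -![(_ + _ : _ -> _) _]/(_ + _) /= /cst.
  by rewrite H (nbhs_singleton fg).
by apply/diff_locallyP; rewrite (diff_unique dc E).
Qed.

(** Scaling is registered as a bilinear map so that the Leibniz rule for a scalar function times a
    vector function is a case of the rule for bilinear maps. *)
Lemma scale_bilinear W : bilinear_for
    (GRing.Scale.Law.clone _ _ *:%R _) (GRing.Scale.Law.clone _ _ *:%R _)
    (@GRing.scale R W : R^o -> W -> W).
Proof.
split=> [u'|u] a x y /=.
- by rewrite scalerDl scalerA.
- by rewrite scalerDr !scalerA mulrC.
Qed.

HB.instance Definition _ W := bilinear_isBilinear.Build R R^o W W _ _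
  (@GRing.scale R W : R^o -> W -> W) (scale_bilinear W).

Lemma is_diff_scale V W (a : V -> R^o) (f : V -> W) x :
  differentiable a x -> differentiable f x ->
  is_diff x (fun y => a y *: f y)
    (fun v => a x *: 'd f x v + 'd a x v *: f x).
Proof.
move=> da df.
have sc : continuous (fun p : R^o * W => p.1 *: p.2) by exact: scale_continuous.
pose s : {bilinear R^o -> W -> W} := (@GRing.scale R W : R^o -> W -> W).
have ds := differentiable_bilin (f := s) (a x, f x) sc.
have dp := differentiable_pair da df.
apply: DiffDef.
  exact: (differentiable_comp dp ds).
rewrite (diff_comp dp ds) (diff_bilin _ sc) /=.
by rewrite (diff_pair da df).
Qed.

Lemma derive_scale V W (a : V -> R^o) (f : V -> W) x v :
  differentiable a x -> differentiable f x ->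
  'D_v (fun y => a y *: f y) x = a x *: 'D_v f x + 'D_v a x *: f x.
Proof.
move=> da df; have [ds e] := is_diff_scale da df.
by rewrite deriveE // e deriveE // deriveE.
Qed.

Lemma derive_comp V W (W' : normedModType R) (f : V -> W) (g : W -> W') x v :
  differentiable f x -> differentiable g (f x) ->
  'D_v (g \o f) x = 'D_('D_v f x) g (f x).
Proof.
move=> df dg; rewrite deriveE; last exact: differentiable_comp.
by rewrite diff_comp // (deriveE _ dg) (deriveE _ df).
Qed.

Lemma derive_pair V W (W' : normedModType R) (f : V -> W) (g : V -> W') x v :
  differentiable f x -> differentiable g x ->
  'D_v (fun y => (f y, g y)) x = ('D_v f x, 'D_v g x).
Proof.
move=> df dg; rewrite deriveE; last exact: differentiable_pair.
by rewrite diff_pair // !deriveE.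
Qed.

Lemma derive_lin V W (f : {linear V -> W}) x v :
  continuous f -> 'D_v f x = f v.
Proof.
by move=> cf; rewrite deriveE ?diff_lin //; exact: linear_differentiable.
Qed.

Lemma derive_dirD V W (f : V -> W) x u v : differentiable f x ->
  'D_(u + v) f x = 'D_u f x + 'D_v f x.
Proof. by move=> df; rewrite !deriveE // linearD. Qed.

Lemma derive_dirZ V W (f : V -> W) x a v : differentiable f x ->
  'D_(a *: v) f x = a *: 'D_v f x.
Proof. by move=> df; rewrite !deriveE // linearZ. Qed.

Lemma derive_dir_sum V W (f : V -> W) x (I : finType) (v : I -> V) :
  differentiable f x ->
  'D_(\sum_i v i) f x = \sum_i 'D_(v i) f x.
Proof.
by move=> df; rewrite deriveE // linear_sum; apply: eq_bigr => i _; rewrite deriveE.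
Qed.

Lemma derive_sumf V W (I : finType) (h : I -> V -> W) x v :
  (forall i, differentiable (h i) x) ->
  differentiable (fun y => \sum_i h i y) x /\
  'D_v (fun y => \sum_i h i y) x = \sum_i 'D_v (h i) x.
Proof.
move=> dh; elim: (index_enum I) => [|i s [IH1 IH2]].
  rewrite big_nil; under eq_fun do rewrite big_nil.
  by split; [exact: differentiable_cst|exact: derive_cst].
rewrite big_cons; under eq_fun do rewrite big_cons.
split; first exact: differentiableD.
by rewrite deriveD ?IH2 //; exact: diff_derivable.
Qed.

Lemma near_open V (U : set V) (P : V -> Prop) x :
  open U -> U x -> (forall y, U y -> P y) -> \near x, P x.
Proof. by move=> oU Ux UP; apply: filterS (open_nbhs_nbhs (conj oU Ux)). Qed.

Lemma classC_sub V W k (U U' : set V) (f : V -> W) :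
  U `<=` U' -> classC k U' f -> classC k U f.
Proof.
move=> UU'; elim: k f => [|k IH] f /=; first by move=> H x /UU'/H.
by case=> H1 H2; split=> [x /UU'/H1 //|v]; apply: IH.
Qed.

(** [classC] only imposes conditions at the points of the set, one point at a time; hence [O] may
    depend on [x]. *)
Lemma classC_local V W k (U : set V) (f : V -> W) :
  (forall x, U x -> exists2 O : set V, O x & classC k O f) -> classC k U f.
Proof.
elim: k f => [|k IH] f /= H; first by move=> x /H[B Bx]; apply.
split; first by move=> x /H[B Bx [h _]]; exact: h.
by move=> v; apply: IH => x /H[B Bx [_ h]]; exists B.
Qed.

Lemma classC_eq V W k (U : set V) (f g : V -> W) : open U ->
  (forall x, U x -> f x = g x) -> classC k U f -> classC k U g.
Proof.
move=> oU; elim: k f g => [|k IH] f g fg /=.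
  move=> H x Ux; have nfg := near_open oU Ux fg.
  suff : g @ x --> g x by [].
  rewrite -(fg _ Ux); apply: cvg_trans (H _ Ux).
  by apply: near_eq_cvg.
case=> H1 H2; split=> [x Ux|v].
  exact: near_eq_differentiable (near_open oU Ux fg) (H1 _ Ux).
apply: IH (H2 v) => x Ux; apply: near_eq_derive.
exact: near_open oU Ux fg.
Qed.

Lemma classC_W V W k (U : set V) (f : V -> W) :
  classC k.+1 U f -> classC k U f.
Proof.
elim: k f => [|k IH] f [H1 H2]; first by move=> x /H1/differentiable_continuous.
by split=> // v; apply: IH.
Qed.

Lemma classC_cst V W k (U : set V) (w : W) : classC k U (fun=> w).
Proof.
elim: k w => [|k IH] w /=; first by move=> x _; exact: cvg_cst.
split=> [x _|v]; first exact: differentiable_cst.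
rewrite (_ : 'D_v _ = fun=> 0) //; apply/funext => x; exact: derive_cst.
Qed.

Lemma classC_lin V W k (U : set V) (f : {linear V -> W}) : continuous f ->
  classC k U f.
Proof.
move=> cf; case: k => [|k]; first by move=> x _; exact: cf.
split=> [x _|v]; first exact: linear_differentiable.
rewrite (_ : 'D_v _ = fun=> f v); first exact: classC_cst.
by apply/funext => x; rewrite derive_lin.
Qed.

Lemma classC_id V k (U : set V) : classC k U id.
Proof. by apply: (@classC_lin V V k U idfun) => x; exact: cvg_id. Qed.

Lemma classC_fst V W k (U : set (V * W)) : classC k U fst.
Proof. by apply: (@classC_lin _ V k U fst) => x; exact: cvg_fst. Qed.

Lemma classC_snd V W k (U : set (V * W)) : classC k U snd.
Proof. by apply: (@classC_lin _ W k U snd) => x; exact: cvg_snd. Qed.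

Lemma classC_add V W k (U : set V) (f g : V -> W) : open U ->
  classC k U f -> classC k U g -> classC k U (fun x => f x + g x).
Proof.
move=> oU; elim: k f g => [|k IH] f g.
  by move=> cf cg x Ux; apply: cvgD; [exact: cf|exact: cg].
case=> df Df [dg Dg]; split=> [x Ux|v].
  by apply: differentiableD; [exact: df|exact: dg].
apply: classC_eq (IH _ _ (Df v) (Dg v)) => // x Ux /=.
by rewrite -deriveD //; apply: diff_derivable; [exact: df|exact: dg].
Qed.

Lemma classC_sum V W k (U : set V) (I : finType) (f : I -> V -> W) : open U ->
  (forall i, classC k U (f i)) -> classC k U (fun x => \sum_i f i x).
Proof.
move=> oU H; elim: (index_enum I) => [|i s IH].
  under eq_fun do rewrite big_nil.
  exact: classC_cst.
under eq_fun do rewrite big_cons.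
exact: classC_add.
Qed.

Lemma classC_scale V W k (U : set V) (a : V -> R^o) (f : V -> W) : open U ->
  classC k U a -> classC k U f -> classC k U (fun x => a x *: f x).
Proof.
move=> oU; elim: k a f => [|k IH] a f.
  by move=> ca cf x Ux; apply: cvgZ; [exact: ca|exact: cf].
move=> Ca Cf; have [da Da] := Ca; have [df Df] := Cf; split=> [x Ux|v].
  by have [] := is_diff_scale (da _ Ux) (df _ Ux).
have C1 := IH _ _ (classC_W Ca) (Df v).
have C2 := IH _ _ (Da v) (classC_W Cf).
apply: classC_eq (classC_add oU C1 C2) => // x Ux /=.
by rewrite derive_scale //; [exact: da|exact: df].
Qed.

Lemma classC_linpost V W (W' : normedModType R) k (U : set V) (f : V -> W)
  (h : {linear W -> W'}) : open U -> continuous h ->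
  classC k U f -> classC k U (fun x => h (f x)).
Proof.
move=> oU ch; elim: k f => [|k IH] f.
  by move=> cf x Ux; apply: continuous_comp; [exact: cf|exact: ch].
have dh x : differentiable h x by exact: linear_differentiable.
case=> df Df; split=> [x Ux|v].
  by apply: differentiable_comp => //; exact: df.
apply: classC_eq (IH _ (Df v)) => // x Ux /=.
by rewrite -[RHS]/('D_v (h \o f) x) (derive_comp _ (df _ Ux) (dh _)) derive_lin.
Qed.

Lemma classC_pair V W (W' : normedModType R) k (U : set V) (f : V -> W)
  (g : V -> W') : open U ->
  classC k U f -> classC k U g -> classC k U (fun x => (f x, g x)).
Proof.
move=> oU; elim: k f g => [|k IH] f g.
  by move=> cf cg x Ux; apply: cvg_pair; [exact: cf|exact: cg].
case=> df Df [dg Dg]; split=> [x Ux|v].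
  by apply: differentiable_pair; [exact: df|exact: dg].
apply: classC_eq (IH _ _ (Df v) (Dg v)) => // x Ux /=.
by rewrite derive_pair //; [exact: df|exact: dg].
Qed.

Definition finite_dim W := exists (I : finType) (e : I -> W) (phi : I -> {linear W -> R^o}),
  (forall i, continuous (phi i)) /\ forall w, w = \sum_i phi i w *: e i.

(** The chain rule produces ['D_('D_v f x) g (f x)], whose direction moves with [x], while [classC]
    speaks of constant directions. Expanding the direction in finitely many coordinates leaves
    products of functions covered by the induction hypothesis. *)
Lemma classC_comp V W (W' : normedModType R) k (U : set V) (U' : set W)
    (f : V -> W) (g : W -> W') : finite_dim W -> open U ->
  (forall x, U x -> U' (f x)) ->
  classC k U f -> classC k U' g -> classC k U (g \o f).
Proof.
move=> [N [e [phi [cphi phiE]]]] oU UU'; elim: k g => [|k IH] g.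
  by move=> cf cg x Ux; apply: continuous_comp; [exact: cf|exact: (cg _ (UU' _ Ux))].
move=> Cf Cg; have [df Df] := Cf; have [dg Dg] := Cg; split=> [x Ux|v].
  by apply: differentiable_comp; [exact: df|exact: (dg _ (UU' _ Ux))].
have H : classC k U (fun x => \sum_i phi i ('D_v f x) *: 'D_(e i) g (f x)).
  apply: classC_sum => // i; apply: classC_scale => //.
    by apply: classC_linpost => //; exact: Df.
  exact: (IH _ (classC_W Cf) (Dg _)).
apply: classC_eq H => // x Ux.
have dgx : differentiable g (f x) by exact: (dg _ (UU' _ Ux)).
rewrite (derive_comp _ (df _ Ux) dgx) [X in 'D_X g _]phiE derive_dir_sum //.
by apply: eq_bigr => i _; rewrite derive_dirZ.
Qed.

(** The codomain is [R^o] so that coordinates are linear maps between normed modules. *)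
Definition row_coord n (i : 'I_n) (v : 'rV[R]_n) : R^o := v 0 i.

Lemma row_coord_linear n (i : 'I_n) : linear (row_coord i).
Proof. by move=> a u v; rewrite /row_coord !mxE. Qed.

HB.instance Definition _ n (i : 'I_n) :=
  GRing.isLinear.Build R 'rV[R]_n R^o _ (row_coord i) (row_coord_linear i).

Lemma row_coord_continuous n (i : 'I_n) : continuous (row_coord i).
Proof. exact: coord_continuous. Qed.

Lemma finite_dim_rV n : finite_dim 'rV[R]_n.
Proof.
exists 'I_n, (fun i => delta_mx 0 i), (fun i => row_coord i : {linear _ -> _}).
split; first exact: row_coord_continuous.
by move=> w; rewrite [LHS]row_sum_delta.
Qed.

Lemma finite_dim_prod V W : finite_dim V -> finite_dim W ->
  finite_dim (V * W)%type.
Proof.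
move=> [I [e [phi [cphi phiE]]]] [J [e' [psi [cpsi psiE]]]].
exists (I + J)%type, (fun i => match i with
  inl j => (e j, 0) | inr j => (0, e' j) end).
exists (fun i => match i with
  inl j => (phi j \o fst : {linear (V * W)%type -> R^o})
  | inr j => (psi j \o snd : {linear (V * W)%type -> R^o}) end); split.
  case=> i x; apply: continuous_comp.
  - exact: cvg_fst.
  - exact: cphi.
  - exact: cvg_snd.
  - exact: cpsi.
move=> [v w]; rewrite big_sumType /=.
rewrite {1}[v]phiE {1}[w]psiE.
have -> : (\sum_i phi i v *: e i, \sum_i psi i w *: e' i) =
  (\sum_i phi i v *: e i, 0) + (0, \sum_i psi i w *: e' i) :> V * W.
  by congr pair; rewrite ?addr0 ?add0r.
congr (_ + _).
  by elim/big_rec2: _ => // i x y _ <-; congr pair; rewrite /= scaler0 addr0.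
by elim/big_rec2: _ => // i x y _ <-; congr pair; rewrite /= scaler0 addr0.
Qed.

End Differentiation.

(** * Charts of a manifold and of its tangent bundle *)

Lemma open_preimage (T T' : topologicalType) (U : set T) (D : set T')
    (f : T -> T') : open U -> open D ->
  (forall x, U x -> {for x, continuous f}) -> open (U `&` f @^-1` D).
Proof.
move=> oU oD cf; rewrite openE => x [Ux Dx]; apply: filterI.
  exact: open_nbhs_nbhs.
by apply: cf => //; exact: open_nbhs_nbhs.
Qed.

(** The chain rule with the intermediate chart cancelled, since [param d] undoes [chart d] near the
    point. It serves three maps: the identity (change of chart), left translations, and their
    tangent maps. *)
Lemma derive_via_chart (R : realType) (V W W' : normedModType R) (M N : Type)
    (A : atlas M V) (B : atlas N W) (c : Defs.index A) (d : Defs.index B) (f : M -> N)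
    (g : N -> W') x y :
  (forall q, dom d q -> param d (chart d q) = q) ->
  (\near x, dom d (f (param c x))) ->
  differentiable (chart d \o f \o param c) x ->
  differentiable (g \o param d) (chart d (f (param c x))) ->
  differentiable (g \o f \o param c) x /\
  'D_('D_y (chart d \o f \o param c) x) (g \o param d) (chart d (f (param c x)))
  = 'D_y (g \o f \o param c) x.
Proof.
move=> dK nd df dg.
have e : \near x, ((g \o param d) \o (chart d \o f \o param c)) x
    = (g \o f \o param c) x.
  by apply: filterS nd => z dz /=; rewrite dK.
split; first exact: near_eq_differentiable e (differentiable_comp df dg).
by rewrite -(derive_comp _ df dg); exact: near_eq_derive.
Qed.

Section Manifold.
Context {R : realType} {V : normedModType R} {M : topologicalType}.
Context {A : atlas M V} (mA : smooth_manifold A).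
Implicit Types (c d : Defs.index A) (p : M) (x y u : V).

Lemma cod_chart c p : dom c p -> cod c (chart c p).
Proof. by move=> cp; exists p. Qed.

Lemma param_dom c x : cod c x -> dom c (param c x).
Proof. by move=> [p cp <-]; rewrite (chartK mA). Qed.

Lemma paramK c x : cod c x -> chart c (param c x) = x.
Proof. by move=> [p cp <-]; rewrite (chartK mA). Qed.

Lemma near_cod c x (P : V -> Prop) : cod c x -> (forall z, cod c z -> P z) ->
  \near x, P x.
Proof. exact/near_open/(cod_open mA). Qed.

Lemma near_param c x (D : set M) : cod c x -> open D -> D (param c x) ->
  \near x, D (param c x).
Proof.
by move=> cx oD Dx; apply: (param_continuous mA cx); exact: open_nbhs_nbhs.
Qed.

Lemma derive_paramK c x y : cod c x -> 'D_y (chart c \o param c) x = y.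
Proof.
move=> cx; rewrite -[RHS](derive_id x y); apply: near_eq_derive.
by apply: near_cod cx _ => z /paramK.
Qed.

Lemma transition_differentiable c d x : cod c x -> dom d (param c x) ->
  differentiable (chart d \o param c) x.
Proof. by move=> cx dx; have [+ _] := transition_smooth mA c d 1; apply. Qed.

Lemma derive_chart (W : normedModType R) (g : M -> W) c d x y :
  cod c x -> dom d (param c x) ->
  differentiable (g \o param d) (chart d (param c x)) ->
  differentiable (g \o param c) x /\
  'D_('D_y (chart d \o param c) x) (g \o param d) (chart d (param c x))
  = 'D_y (g \o param c) x.
Proof.
move=> cx dx dg; have := @derive_via_chart _ _ _ _ _ _ A A c d id g x y.
apply => //; first exact: (chartK mA).
  by apply: near_param cx _ dx; exact: (dom_open mA).
exact: transition_differentiable.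
Qed.

Lemma componentsE c d p u : dom c p -> dom d p ->
  components d p u = 'D_(components c p u) (chart d \o param c) (chart c p).
Proof.
move=> cp dp; have ap := chart_at_dom mA p.
have aK := chartK mA ap.
have := @derive_chart _ (chart d) _ c (chart (chart_at A p) p) u (cod_chart ap).
rewrite aK => /(_ cp)[|_ ->] //.
apply: transition_differentiable; first exact: cod_chart.
by rewrite (chartK mA).
Qed.

Lemma components_chart_at p u : components (chart_at A p) p u = u.
Proof. by apply: derive_paramK; apply: cod_chart; exact: (chart_at_dom mA). Qed.

Lemma vector_ofK c x y : cod c x -> components c (param c x) (vector_of c x y) = y.
Proof.
move=> cx; have ap := chart_at_dom mA (param c x).
rewrite /components /vector_of.
have [|_ ->] := @derive_chart _ (chart c) _ _ x y cx ap.
  apply: transition_differentiable; first exact: cod_chart.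
  by rewrite (chartK mA) //; exact: param_dom.
exact: derive_paramK.
Qed.

Lemma componentsK c p u : dom c p -> vector_of c (chart c p) (components c p u) = u.
Proof.
move=> cp; have ap := chart_at_dom mA p.
by rewrite /vector_of (chartK mA cp) -(componentsE u cp ap) components_chart_at.
Qed.

Lemma tangent_chartK c (v : M * V) : dom c v.1 ->
  param (c : Defs.index (tangent_atlas A)) (chart (c : Defs.index (tangent_atlas A)) v) = v.
Proof.
by case: v => p u cp; rewrite /= (chartK mA cp) componentsK.
Qed.

Lemma tangent_codP c (z : V * V) :
  cod (c : Defs.index (tangent_atlas A)) z <-> cod c z.1.
Proof.
split=> [[v cv <-]|cz]; first exact: cod_chart.
exists (param (c : Defs.index (tangent_atlas A)) z); first exact: param_dom.
by case: z cz => x y cx; rewrite /= paramK // vector_ofK.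
Qed.

End Manifold.

(** * Group operations in charts *)

Section LieGroupCharts.
Context {R : realType} {n : nat} {G : groupTopologicalType}.
Local Notation V := 'rV[R]_n.
Context {A : atlas G V} (hG : lie_group A).
Implicit Types (c d e : Defs.index A) (p h : G) (x y u : V).
Local Open Scope group_scope.

Lemma lie_group_manifold : smooth_manifold A. Proof. by case: hG. Qed.
Local Notation mA := lie_group_manifold.

Definition mul_dom c d e : set (V * V) :=
  [set z | [/\ cod c z.1, cod d z.2 & dom e (param c z.1 * param d z.2)]].

Definition mul_chart c d e (z : V * V) : V := chart e (param c z.1 * param d z.2).

Lemma mul_chart_smooth c d e : smooth_on (mul_dom c d e) (mul_chart c d e).
Proof.
have [_ [_ H] _] := hG; move=> k; apply: classC_sub (H (c, d) e k).
move=> [x y] [/= cx dy ez]; split=> //.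
exists (param c x, param d y); first by split; exact: (param_dom mA).
by rewrite /= !(paramK mA).
Qed.

Lemma mul_cvg (p q : G) : {for (p, q), continuous (fun z : G * G => z.1 * z.2)}.
Proof. by have [_ [H _] _] := hG; exact: H. Qed.

Lemma inv_cvg p : {for p, continuous (fun z : G => z^-1)}.
Proof. by have [_ _ [H _]] := hG; exact: H. Qed.

Lemma ltrans_cvg h : continuous (fun p : G => h * p).
Proof.
move=> p; apply: (@continuous_comp _ _ _ (fun p => (h, p))
  (fun z : G * G => z.1 * z.2)); last exact: mul_cvg.
by apply: cvg_pair; [exact: cvg_cst|exact: cvg_id].
Qed.

Lemma cod_prod_open c d : open [set z : V * V | cod c z.1 /\ cod d z.2].
Proof.
rewrite (_ : [set _ | _] = (fst @^-1` cod c) `&` (snd @^-1` cod d)) //.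
by apply: openI; apply: open_comp; do ?[exact: (cod_open mA)];
  move=> z _; [exact: cvg_fst|exact: cvg_snd].
Qed.

Lemma inv_smooth c e :
  smooth_on (cod c `&` (fun x => (param c x)^-1) @^-1` dom e)
    (fun x => chart e (param c x)^-1).
Proof. by have [_ _ [_ H]] := hG; exact: (H c e). Qed.

Lemma inv_dom_open c e :
  open (cod c `&` (fun x => (param c x)^-1) @^-1` dom e).
Proof.
apply: open_preimage; [exact: (cod_open mA)|exact: (dom_open mA)|].
move=> x cx; apply: continuous_comp; first exact: (param_continuous mA).
exact: inv_cvg.
Qed.

Definition ltrans_dom h c e : set V := [set x | cod c x /\ dom e (h * param c x)].

Lemma ltrans_dom_open h c e : open (ltrans_dom h c e).
Proof.
apply: (@open_preimage _ _ (cod c) (dom e) (fun x => h * param c x)).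
- exact: (cod_open mA).
- exact: (dom_open mA).
move=> x cx; apply: (@continuous_comp _ _ _ (param c) (fun p => h * p)).
  exact: (param_continuous mA).
exact: ltrans_cvg.
Qed.

(** Left translation is multiplication with its first argument frozen at the coordinates of [h] in a
    chart around [h]. *)
Lemma ltrans_chart_smooth h c e :
  smooth_on (ltrans_dom h c e) (fun x => chart e (h * param c x)).
Proof.
move=> k; set a := chart_at A h; have ah := chart_at_dom mA h.
have Cp : classC k (ltrans_dom h c e) (fun x : V => (chart a h, x)).
  apply: classC_pair; [exact: ltrans_dom_open|exact: classC_cst|].
  exact: classC_id.
have := classC_comp (U' := mul_dom a c e) (finite_dim_prod (finite_dim_rV n)
  (finite_dim_rV n)) (@ltrans_dom_open h c e) _ Cp (@mul_chart_smooth a c e k).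
rewrite (_ : mul_chart a c e \o _ = fun x => chart e (h * param c x)); last first.
  by apply/funext => x /=; rewrite /mul_chart /= (chartK mA ah).
by apply=> x [cx ex]; split=> //=; [exact: cod_chart|rewrite (chartK mA ah)].
Qed.

Lemma ltrans_chart_diff h c e x : cod c x -> dom e (h * param c x) ->
  differentiable (chart e \o (fun p => h * p) \o param c) x.
Proof. by move=> cx ex; have [+ _] := @ltrans_chart_smooth h c e 1%N; apply. Qed.

Lemma derive_ltrans (W : normedModType R) (g : G -> W) h c d x y :
  cod c x -> dom d (h * param c x) ->
  differentiable (g \o param d) (chart d (h * param c x)) ->
  differentiable (g \o (fun p => h * p) \o param c) x /\
  'D_('D_y (chart d \o (fun p => h * p) \o param c) x) (g \o param d)
      (chart d (h * param c x))
  = 'D_y (g \o (fun p => h * p) \o param c) x.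
Proof.
move=> cx dx dg; apply: derive_via_chart => //; first exact: (chartK mA).
  by apply: (near_open (@ltrans_dom_open h c d)) => // z [].
exact: ltrans_chart_diff.
Qed.

(** Functoriality of the tangent map: the preferred chart at the intermediate point [h * p] drops
    out by the chain rule. *)
Lemma ltransM g h v : ltrans A g (ltrans A h v) = ltrans A (g * h) v.
Proof.
case: v => p u; rewrite /ltrans /tangent_map /= mulgA; congr pair.
have ap := chart_at_dom mA p; have aK := chartK mA ap.
have := @derive_ltrans _ (chart (chart_at A (g * h * p)) \o (fun p => g * p))
  h (chart_at A p) (chart_at A (h * p)) (chart (chart_at A p) p) u (cod_chart ap).
rewrite aK => /(_ (chart_at_dom mA _))[|_ e].
  apply: ltrans_chart_diff; first exact: (cod_chart (chart_at_dom mA _)).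
  rewrite (chartK mA (chart_at_dom mA _)) mulgA; exact: chart_at_dom mA _.
have fE : chart (chart_at A (g * h * p)) \o (fun q => g * h * q) =
    (chart (chart_at A (g * h * p)) \o (fun q => g * q)) \o (fun q => h * q).
  by apply/funext => q /=; rewrite mulgA.
by rewrite fE e.
Qed.

Lemma ltrans1 v : ltrans A 1 v = v.
Proof.
case: v => p u; rewrite /ltrans /tangent_map /= mul1g; congr pair.
rewrite -[RHS](components_chart_at mA p u) /components.
suff -> : chart (chart_at A p) \o (fun q => 1 * q) = chart (chart_at A p) by [].
by apply/funext => q /=; rewrite mul1g.
Qed.

End LieGroupCharts.

Section PartialDerivatives.
Context {R : realType}.
Implicit Types V W : normedModType R.

Lemma derive_partial2 V W (W' : normedModType R) (F : V * W -> W') x y v :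
  differentiable F (x, y) -> 'D_v (fun z => F (x, z)) y = 'D_(0, v) F (x, y).
Proof.
move=> dF; have dp : differentiable (fun z : W => (x, z)) y.
  by apply: differentiable_pair; [exact: differentiable_cst|exact: ex_diff].
rewrite -[LHS]/('D_v (F \o (fun z => (x, z))) y) derive_comp // derive_pair //.
by rewrite derive_cst derive_id.
Qed.

End PartialDerivatives.

(** * The left Maurer-Cartan form and its smoothness *)

Section MaurerCartan.
Context {R : realType} {n : nat} {G : groupTopologicalType}.
Local Notation V := 'rV[R]_n.
Context {A : atlas G V} (hG : lie_group A).
Implicit Types (c d : Defs.index A) (p h : G) (x y u : V).
Local Notation mA := (lie_group_manifold hG).
Local Notation T := (tangent_atlas A).

Definition theta (v : G * V) : V := (ltrans A v.1^-1%g v).2.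

Lemma ltrans_theta v : ltrans A v.1^-1%g v = (1%g, theta v).
Proof. by rewrite /theta [LHS]surjective_pairing /= mulVg. Qed.

Lemma theta_ltrans h v : theta (ltrans A h v) = theta v.
Proof. by rewrite /theta (ltransM hG) -[(ltrans A h v).1]/(h * v.1)%g invgM mulgVK. Qed.

Lemma theta1 u : theta (1%g, u) = u.
Proof. by rewrite /theta -[(1%g, u).1]/(1%g : G) invg1 (ltrans1 hG). Qed.

Lemma ltrans_left_field u p : ltrans A p (1%g, u) = (p, left_field A u p).
Proof. by rewrite /left_field [LHS]surjective_pairing /= mulg1. Qed.

Lemma theta_left_field u p : theta (p, left_field A u p) = u.
Proof. by rewrite -ltrans_left_field theta_ltrans theta1. Qed.

Lemma left_field_theta p u : left_field A (theta (p, u)) p = u.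
Proof.
rewrite /left_field -(ltrans_theta (p, u)) (ltransM hG).
by rewrite -[(p, u).1]/p mulgV (ltrans1 hG).
Qed.

Definition div_dom c : set (V * V) :=
  [set z | (cod c z.1 /\ cod c z.2) /\
           dom (chart_at A 1%g) ((param c z.1)^-1 * param c z.2)%g].

(** Near the diagonal the quotient p^-1 q is close to the identity, so one fixed target chart is
    enough. The derivative in the second variable on the diagonal is [theta]. *)
Definition div_chart c (z : V * V) : V :=
  chart (chart_at A 1%g) ((param c z.1)^-1 * param c z.2)%g.

Lemma div_dom_open c : open (div_dom c).
Proof.
apply: (@open_preimage _ _ [set z : V * V | cod c z.1 /\ cod c z.2]
  (dom (chart_at A 1%g)) (fun z : V * V => ((param c z.1)^-1 * param c z.2)%g)).
- exact: cod_prod_open hG _ _.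
- exact: (dom_open mA).
move=> [x y] [cx cy]; apply: (@continuous_comp _ _ _
  (fun z : V * V => ((param c z.1)^-1%g, param c z.2))
  (fun z : G * G => (z.1 * z.2)%g)); last exact: (mul_cvg hG).
apply: cvg_pair.
  apply: (@continuous_comp _ _ _ (param c \o fst) (fun p => p^-1%g)).
    apply: (@continuous_comp _ _ _ fst (param c)); first exact: cvg_fst.
    exact: (param_continuous mA).
  exact: (inv_cvg hG).
apply: (@continuous_comp _ _ _ snd (param c)); first exact: cvg_snd.
exact: (param_continuous mA).
Qed.

Lemma div_chart_smooth c : smooth_on (div_dom c) (div_chart c).
Proof.
move=> k; apply: classC_local => -[a b] [[/= ca cb] dab].
(* Division is inversion followed by multiplication, and the inverse has to be read in some chart
   [d]. No single [d] serves the whole of [div_dom c], hence the localization around (a, b). *)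
set d := chart_at A (param c a)^-1%g; have dd := chart_at_dom mA (param c a)^-1%g.
pose I : set V := cod c `&` (fun x => (param c x)^-1%g) @^-1` dom d.
have oI : open I by exact: (inv_dom_open hG).
pose B : set (V * V) := div_dom c `&` fst @^-1` I.
have oB : open B.
  apply: openI; first exact: div_dom_open.
  by apply: open_comp => // z _; exact: cvg_fst.
exists B; first by split.
have C1 : classC k B (fun z : V * V => (chart d (param c z.1)^-1%g, z.2)).
  apply: classC_pair => //; last exact: classC_snd.
  apply: (classC_comp (U' := I) (g := fun x => chart d (param c x)^-1%g)
    (finite_dim_rV n) oB) => //.
  - by move=> z [].
  - exact: classC_fst.
  - exact: (inv_smooth hG).
have := classC_comp (U' := mul_dom d c (chart_at A 1%g))
  (finite_dim_prod (finite_dim_rV n) (finite_dim_rV n)) oB _ C1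
  (@mul_chart_smooth _ _ _ _ hG d c (chart_at A 1%g) k).
have BE z : B z -> param d (chart d (param c z.1)^-1%g) = (param c z.1)^-1%g.
  by move=> [_ [_ dz]]; rewrite (chartK mA).
move=> H; apply: classC_eq oB _ (H _).
  by move=> z Bz /=; rewrite /mul_chart /div_chart /= BE.
move=> z Bz; split => /=.
- by case: Bz => _ [_ dz]; exact: cod_chart.
- by case: Bz => [[[]]].
- by rewrite BE //; case: Bz => [[]].
Qed.

Lemma div_dom_diag c x : cod c x -> div_dom c (x, x).
Proof. by move=> cx; split=> //=; rewrite mulVg; exact: (chart_at_dom mA). Qed.

(** The value of [theta] on the [i]-th coordinate vector at [x], in a form whose smoothness in [x]
    is inherited from [div_chart]. *)
Definition theta_col c (i : 'I_n) x : V := 'D_(0, delta_mx 0 i) (div_chart c) (x, x).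

Lemma theta_col_smooth c i : smooth_on (cod c) (theta_col c i).
Proof.
move=> k; have [_ /(_ (0, delta_mx 0 i)) H] := @div_chart_smooth c k.+1.
apply: (classC_comp (U' := div_dom c) (f := fun x : V => (x, x))
  (finite_dim_prod (finite_dim_rV n) (finite_dim_rV n)) (cod_open mA c) _ _ H).
  exact: div_dom_diag.
by apply: classC_pair; [exact: (cod_open mA)|exact: classC_id|exact: classC_id].
Qed.

Definition theta_chart c (z : V * V) : V :=
  theta (param (c : Defs.index T) z).

Lemma theta_chart_derive c x y : cod c x ->
  theta_chart c (x, y) = 'D_(0, y) (div_chart c) (x, x).
Proof.
move=> cx; have dx := div_dom_diag cx.
have [dd _] := @div_chart_smooth c 1.
rewrite -derive_partial2; last exact: dd.
rewrite /theta_chart /theta /ltrans /tangent_map /= mulVg.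
set p := param c x; have ap := chart_at_dom mA p.
(* The preferred chart at [p], through which [theta] is defined, is traded here for the fixed chart
   [c]. *)
have [|_ ->] // := derive_chart mA
  (g := chart (chart_at A 1%g) \o (fun q => p^-1 * q)%g) y cx ap.
apply: (ltrans_chart_diff hG); first exact: cod_chart.
rewrite (chartK mA) //.
by rewrite /p mulVg; exact: (chart_at_dom mA).
Qed.

Lemma theta_chartE c x y : cod c x ->
  theta_chart c (x, y) = \sum_i row_coord i y *: theta_col c i x.
Proof.
move=> cx; have dx := div_dom_diag cx; have [dd _] := @div_chart_smooth c 1.
rewrite theta_chart_derive // -derive_partial2; last exact: dd.
have d2 : differentiable (fun z => div_chart c (x, z)) x.
  apply: (@differentiable_comp _ _ _ _ (fun z => (x, z)) (div_chart c)); last exact: dd.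
  by apply: differentiable_pair; [exact: differentiable_cst|exact: ex_diff].
rewrite [y in LHS]row_sum_delta derive_dir_sum //; apply: eq_bigr => i _.
by rewrite derive_dirZ // derive_partial2 //; exact: dd.
Qed.

Lemma tangent_cod_open c : open (cod (c : Defs.index T)).
Proof.
rewrite (_ : cod _ = fst @^-1` cod c); last first.
  by apply/seteqP; split=> z /=; rewrite (tangent_codP mA).
by apply: open_comp; [move=> z _; exact: cvg_fst|exact: (cod_open mA)].
Qed.

Lemma theta_chart_smooth c : smooth_on (cod (c : Defs.index T)) (theta_chart c).
Proof.
move=> k; have oT := @tangent_cod_open c.
have H : classC k (cod (c : Defs.index T))
    (fun z : V * V => \sum_i row_coord i z.2 *: theta_col c i z.1).
  apply: classC_sum => // i; apply: classC_scale => //.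
    apply: classC_linpost => //; first exact: row_coord_continuous.
    exact: classC_snd.
  apply: (classC_comp (U' := cod c) (g := theta_col c i) (finite_dim_rV n)) => //.
  - by move=> z /(tangent_codP mA).
  - exact: classC_fst.
  - exact: theta_col_smooth.
apply: classC_eq H => // -[x y] /(tangent_codP mA) cx.
by rewrite theta_chartE.
Qed.

End MaurerCartan.

(** * Tangent maps of left translations in induced charts *)

Section TangentTranslation.
Context {R : realType} {n : nat} {G : groupTopologicalType}.
Local Notation V := 'rV[R]_n.
Context {A : atlas G V} (hG : lie_group A).
Implicit Types (c d e : Defs.index A) (p h : G) (x y u : V).
Local Notation mA := (lie_group_manifold hG).
Local Notation T := (tangent_atlas A).
Local Open Scope group_scope.

Lemma tangent_lift_smooth (W : normedModType R) (U : set V) (F : V -> W) :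
  open U -> smooth_on U F ->
  smooth_on (fst @^-1` U) (fun z : V * V => (F z.1, 'D_(z.2) F z.1)).
Proof.
move=> oU sF k; have oU2 : open ((fst : V * V -> V) @^-1` U).
  by apply: open_comp => // z _; exact: cvg_fst.
apply: classC_pair => //.
  exact: (classC_comp (U' := U) (f := fst : V * V -> V) (finite_dim_rV n) oU2
    (fun z H => H) (@classC_fst _ _ _ _ _) (sF k)).
have [_ D1] := sF k.+1.
have H : classC k (fst @^-1` U)
    (fun z : V * V => \sum_i row_coord i z.2 *: 'D_(delta_mx 0 i) F z.1).
  apply: classC_sum => // i; apply: classC_scale => //.
    apply: classC_linpost => //; first exact: row_coord_continuous.
    exact: classC_snd.
  exact: (classC_comp (U' := U) (f := fst : V * V -> V) (finite_dim_rV n) oU2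
    (fun z H => H) (@classC_fst _ _ _ _ _) (D1 _)).
apply: classC_eq H => // -[x y] Ux /=; have [/(_ _ Ux) dF _] := sF 1%N.
rewrite [y in RHS]row_sum_delta derive_dir_sum //.
by apply: eq_bigr => i _; rewrite derive_dirZ.
Qed.

(** [ltrans] passes through two preferred charts, at the base point and at its translate. The chain
    rule eliminates both, which leaves the tangent lift of the translation read in [c] and [e]. *)
Lemma ltrans_tangent_chart h c e (z : V * V) :
  cod c z.1 -> dom e (h * param c z.1) ->
  chart (e : Defs.index T) (ltrans A h (param (c : Defs.index T) z)) =
  (chart e (h * param c z.1),
   'D_(z.2) (chart e \o (fun p => h * p) \o param c) z.1).
Proof.
case: z => x y /= cx ex; congr pair.
set p := param c x; set a := chart_at A p; set b := chart_at A (h * p).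
have ap : dom a p := chart_at_dom mA p.
have bq : dom b (h * p) := chart_at_dom mA (h * p).
have eE : 'D_(vector_of c x y) (chart b \o (fun p => h * p) \o param a) (chart a p)
    = 'D_y (chart b \o (fun p => h * p) \o param c) x.
  have [|_ <- //] := derive_chart mA (g := chart b \o (fun p => h * p)) y cx ap.
  apply: (ltrans_chart_diff hG); first exact: cod_chart.
  by rewrite (chartK mA).
rewrite eE /components -/b.
have [|_ ->] // := derive_ltrans hG (g := chart e) (d := b) y cx bq.
apply: (transition_differentiable mA); first exact: cod_chart.
by rewrite (chartK mA).
Qed.

Lemma ltrans_tangent_open h c e :
  open ((fst : V * V -> V) @^-1` ltrans_dom h c e).
Proof.
by apply: open_comp; [move=> z _; exact: cvg_fst|exact: (ltrans_dom_open hG)].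
Qed.

Lemma ltrans_tangent_differentiable h c e (z : V * V) :
  cod c z.1 -> dom e (h * param c z.1) ->
  differentiable (chart (e : Defs.index T) \o ltrans A h
                  \o param (c : Defs.index T)) z.
Proof.
move=> cz ez; have [+ _] := tangent_lift_smooth (@ltrans_dom_open _ _ _ _ hG h c e)
  (@ltrans_chart_smooth _ _ _ _ hG h c e) 1%N.
move=> /(_ z (conj cz ez)); apply: near_eq_differentiable.
apply: (near_open (@ltrans_tangent_open h c e)) => // -[x y] [/= cx ex].
exact/esym/(@ltrans_tangent_chart h c e (x, y)).
Qed.

Lemma derive_ltrans_tangent (W : normedModType R) (g : G * V -> W) h c e
    (z y : V * V) : cod c z.1 -> dom e (h * param c z.1) ->
  differentiable (g \o param (e : Defs.index T))
    (chart (e : Defs.index T) (ltrans A h (param (c : Defs.index T) z))) ->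
  'D_('D_y (chart (e : Defs.index T) \o ltrans A h \o param (c : Defs.index T)) z)
    (g \o param (e : Defs.index T))
    (chart (e : Defs.index T) (ltrans A h (param (c : Defs.index T) z)))
  = 'D_y (g \o ltrans A h \o param (c : Defs.index T)) z.
Proof.
move=> cz ez dg.
have [] // := @derive_via_chart R _ _ _ _ _ T T c e (ltrans A h) g z y.
- by move=> q; exact: (tangent_chartK mA).
- by apply: (near_open (@ltrans_tangent_open h c e)) => // -[x u] [].
- exact: ltrans_tangent_differentiable.
Qed.

End TangentTranslation.

Arguments theta {R n G} A v.

(** * Left-invariant fields and the derivative of the Maurer-Cartan form *)

Section LeftFields.
Context {R : realType} {n : nat} {G : groupTopologicalType}.
Local Notation V := 'rV[R]_n.
Context {A : atlas G V} (hG : lie_group A).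
Implicit Types (c d e : Defs.index A) (p h : G) (x y z u v w : V).
Local Notation mA := (lie_group_manifold hG).
Local Notation T := (tangent_atlas A).

Lemma theta_linear p : linear (fun u => theta A (p, u)).
Proof.
move=> a u w; rewrite /theta /ltrans /tangent_map /=.
have ap := chart_at_dom mA p.
set F := (chart _ \o _ \o _).
have dF : differentiable F (chart (chart_at A p) p).
  apply: (ltrans_chart_diff hG); first exact: cod_chart.
  by rewrite (chartK mA ap); exact: (chart_at_dom mA).
by rewrite derive_dirD // derive_dirZ.
Qed.

Lemma theta_chart_components c x w : cod c x ->
  theta_chart c (x, components c (param c x) w) = theta A (param c x, w).
Proof.
move=> cx; rewrite /theta_chart.
rewrite -[in RHS](tangent_chartK mA (v := (param c x, w)) (param_dom mA cx)).
by rewrite /= (paramK mA cx).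
Qed.

Definition local_field c (X : G -> V) x : V := components c (param c x) (X (param c x)).

(** The value at [p] is the derivative of the product p q in [q] at the identity. This exhibits the
    components as a partial derivative of [mul_chart], hence as smooth functions of [x]. *)
Lemma left_field_components c u x : cod c x ->
  local_field c (left_field A u) x
  = 'D_(0, u) (mul_chart c (chart_at A 1%g) c) (x, chart (chart_at A 1%g) 1%g).
Proof.
move=> cx; set e := chart_at A 1%g.
have e1 : dom e 1%g := chart_at_dom mA 1%g.
have cp := param_dom mA cx.
have [dm _] := @mul_chart_smooth _ _ _ _ hG c e c 1%N.
rewrite -derive_partial2; last first.
  apply: dm; split => //=; first exact: cod_chart.
  by rewrite (chartK mA e1) mulg1.
rewrite /local_field /left_field /ltrans /tangent_map /= mulg1 -/e.
set p := param c x; have ap := chart_at_dom mA p.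
have := @derive_ltrans _ _ _ _ hG _ (chart c) p e (chart_at A p) (chart e 1%g) u
  (cod_chart e1).
rewrite (chartK mA e1) mulg1 => /(_ ap)[|_ E].
  apply: (transition_differentiable mA); first exact: cod_chart.
  by rewrite (chartK mA).
exact: E.
Qed.

Lemma left_field_smooth u : smooth_field A (left_field A u).
Proof.
move=> c k; set e := chart_at A 1%g.
have e1 : dom e 1%g := chart_at_dom mA 1%g.
have oc := cod_open mA c.
have [_ /(_ (0, u)) D] := @mul_chart_smooth _ _ _ _ hG c e c k.+1.
have C1 : classC k (cod c) (fun x : V => (x, chart e 1%g)).
  by apply: classC_pair => //; [exact: classC_id|exact: classC_cst].
have H := classC_comp (finite_dim_prod (finite_dim_rV n) (finite_dim_rV n)) oc _ C1 D.
apply: classC_eq oc _ (H _).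
  by move=> x cx; exact/esym/left_field_components.
move=> x cx; split => //=; first exact: cod_chart.
by rewrite (chartK mA e1) mulg1; exact: (param_dom mA).
Qed.

(* derivative of [theta_chart c (x, y)] in the direction [z] of [x], with the
   components [y] held fixed *)
Definition dtheta_chart c x z y : V :=
  \sum_i row_coord i y *: 'D_z (theta_col c i) x.

Lemma derive_theta_chart c x y z v : cod c x ->
  differentiable (theta_chart c) (x, y) /\
  'D_(z, v) (theta_chart c) (x, y) = dtheta_chart c x z y + theta_chart c (x, v).
Proof.
move=> cx; have [dT _] := @theta_chart_smooth _ _ _ _ hG c 1%N.
have Tx : cod (c : Defs.index T) (x, y) by apply/(tangent_codP mA).
split; first exact: dT.
have ds i : differentiable (theta_col c i \o fst : V * V -> V) (x, y).
  have [d _] := @theta_col_smooth _ _ _ _ hG c i 1%N.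
  apply: differentiable_comp; last exact: d.
  by apply: linear_differentiable => t; exact: cvg_fst.
have cr i : continuous (row_coord i \o snd : {linear (V * V)%type -> R^o}).
  by move=> t; apply: continuous_comp; [exact: cvg_snd|exact: row_coord_continuous].
have dr i : differentiable (row_coord i \o snd : V * V -> R^o) (x, y).
  exact: (@linear_differentiable _ _ _ (row_coord i \o snd : {linear (V * V)%type -> R^o})).
have dsc i : differentiable
    (fun t : V * V => row_coord i t.2 *: theta_col c i t.1) (x, y).
  by have [] := is_diff_scale (dr i) (ds i).
have [_ E] := derive_sumf (z, v) dsc.
transitivity ('D_(z, v) (fun t : V * V => \sum_i row_coord i t.2 *: theta_col c i t.1) (x, y)).
  apply: near_eq_derive; apply: (near_open (@tangent_cod_open _ _ _ _ hG c)) => //.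
  by case=> x' y' /(tangent_codP mA) cx'; rewrite (theta_chartE hG).
rewrite E (theta_chartE hG) // -big_split; apply: eq_bigr => i _ /=.
have -> := derive_scale (z, v) (dr i) (ds i).
rewrite (derive_lin _ _ (cr i)) /=; congr (_ *: _ + _).
Qed.

Lemma derive_theta_field c x z (Y : V -> V) : cod c x -> differentiable Y x ->
  differentiable (fun x' => theta_chart c (x', Y x')) x /\
  'D_z (fun x' => theta_chart c (x', Y x')) x
  = dtheta_chart c x z (Y x) + theta_chart c (x, 'D_z Y x).
Proof.
move=> cx dY; have [dT E] := derive_theta_chart (Y x) z ('D_z Y x) cx.
have di : differentiable (fun x' : V => x') x by exact: ex_diff.
have dp : differentiable (fun x' : V => (x', Y x')) x.
  exact: differentiable_pair di dY.
split; first exact: (differentiable_comp dp dT).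
rewrite -E -[LHS]/('D_z (theta_chart c \o (fun x' => (x', Y x'))) x).
by rewrite (derive_comp z dp dT) (derive_pair z di dY) derive_id.
Qed.

Lemma theta_local_left_field c u x : cod c x ->
  theta_chart c (x, local_field c (left_field A u) x) = u.
Proof. by move=> cx; rewrite theta_chart_components // (theta_left_field hG). Qed.

(** [theta] is constant along a left-invariant field, so the two terms of the product rule for its
    derivative add up to zero. *)
Lemma dtheta_left_field c u x z : cod c x ->
  dtheta_chart c x z (local_field c (left_field A u) x)
  = - theta_chart c (x, 'D_z (local_field c (left_field A u)) x).
Proof.
move=> cx; have [/(_ _ cx) dY _] := @left_field_smooth u c 1%N.
have [_ E] := derive_theta_field z cx dY.
apply/eqP; rewrite -addr_eq0 -E -(derive_cst u x z); apply/eqP.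
by apply: near_eq_derive; apply: (near_cod mA cx) => x' /theta_local_left_field ->.
Qed.

(* The Maurer-Cartan equation. *)
Lemma dtheta_bracket p u w : let c := chart_at A p in let x := chart c p in
  dtheta_chart c x (left_field A w p) (left_field A u p)
  - dtheta_chart c x (left_field A u p) (left_field A w p)
  = theta A (p, bracket A (left_field A u) (left_field A w) p).
Proof.
move=> c x; have cp : dom c p := chart_at_dom mA p; have cx := cod_chart cp.
have locE u' : local_field c (left_field A u') x = left_field A u' p.
  by rewrite /local_field (chartK mA cp) (components_chart_at mA).
have tE y : theta_chart c (x, y) = theta A (p, y).
  by have := theta_chart_components y cx; rewrite (chartK mA cp) (components_chart_at mA p y).
have key (X Y : V -> V) a b : X x = a -> Y x = b ->
    dtheta_chart c x b (X x) = - theta_chart c (x, 'D_b X x) ->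
    dtheta_chart c x a (Y x) = - theta_chart c (x, 'D_a Y x) ->
    dtheta_chart c x b a - dtheta_chart c x a b = theta A (p, 'D_a Y x - 'D_b X x).
  move=> -> -> -> ->; rewrite !tE opprK.
  have := theta_linear p (-1) ('D_b X x) ('D_a Y x).
  by rewrite !scaleN1r addrC [X in theta A (p, X)]addrC => <-.
exact: (key (local_field c (left_field A u)) (local_field c (left_field A w))
  _ _ (locE u) (locE w) (dtheta_left_field u _ cx) (dtheta_left_field w _ cx)).
Qed.

End LeftFields.

(** * The image of the second-order field under the Maurer-Cartan form *)

Section ReducedField.
Context {R : realType} {n : nat} {G : groupTopologicalType}.
Local Notation V := 'rV[R]_n.
Context {A : atlas G V} (hG : lie_group A).
Implicit Types (c d e : Defs.index A) (p h : G) (x y z u v w : V).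
Local Notation mA := (lie_group_manifold hG).
Local Notation T := (tangent_atlas A).

(** For maps known only to satisfy the predicate [linear], such as [theta] on a fixed fibre or
    [dtheta_chart] in one argument. *)
Lemma linear_lincomb (U W : lmodType R) (f : U -> W) (I : finType) (a : I -> R)
    (s : I -> U) : linear f -> f (\sum_i a i *: s i) = \sum_i a i *: f (s i).
Proof.
(* Linearity with scalar -1 at the vectors 0 and 0 reads f 0 = - f 0 + f 0. The same instance is
   used again below. *)
move=> lf; have f0 : f 0 = 0.
  by have := lf (-1) 0 0; rewrite scaler0 addr0 scaleN1r addNr.
by elim/big_rec2: _ => // i y1 y2 _ <-; rewrite lf.
Qed.

Lemma linear_lincomb_eq (U W : lmodType R) (f : U -> W) (I : finType) (a : I -> R)
    (s : I -> U) (v : U) : linear f -> v = \sum_i a i *: s i -> \sum_i a i *: f (s i) = f v.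
Proof. by move=> lf ->; rewrite linear_lincomb. Qed.

Lemma dtheta_chart_linearl c x y : cod c x -> linear (dtheta_chart c x ^~ y).
Proof.
move=> cx a u w; rewrite /dtheta_chart scaler_sumr -big_split.
apply: eq_bigr => i _ /=; have [/(_ _ cx) d _] := @theta_col_smooth _ _ _ _ hG c i 1%N.
by rewrite derive_dirD // derive_dirZ // scalerDr !scalerA mulrC.
Qed.

Lemma dtheta_chart_linearr c x z : linear (dtheta_chart c x z).
Proof.
move=> a u w; rewrite /dtheta_chart scaler_sumr -big_split.
by apply: eq_bigr => i _ /=; rewrite linearP /= scalerDl scalerA.
Qed.

Lemma left_field1 u : left_field A u 1%g = u.
Proof. by have := theta_left_field hG u 1%g; rewrite (theta1 hG). Qed.

Lemma basis_coord (E : n.-tuple V) u : basis_of fullv E ->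
  u = \sum_i coord E i u *: tnth E i.
Proof.
move=> hE; rewrite {1}(coord_basis hE (memvf u)).
by apply: eq_bigr => i _; rewrite (tnth_nth 0).
Qed.

Lemma derive_theta_reduced1 (E : n.-tuple V) (Z : G * V -> V * V) (gamma : V -> V) u :
  basis_of fullv E -> reduced_field A E Z gamma ->
  'D_(Z (1%g, u)) (theta_chart (chart_at A 1%g)) (chart (chart_at A 1%g) 1%g, u)
  = gamma u.
Proof.
move=> hE [Gi [ZE gE]]; set c := chart_at A 1%g; set x := chart c 1%g.
have c1 : dom c 1%g := chart_at_dom mA 1%g.
have cx : cod c x := cod_chart c1.
have wE i : frame_coord A E i (1%g, u) = coord E i u.
  rewrite /frame_coord /=; congr (coord _ i u); apply: eq_from_tnth => j.
  by rewrite tnth_mktuple left_field1.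
pose D i := 'D_u (local_field c (left_field A (tnth E i))) x.
have {}ZE : Z (1%g, u) = \sum_i coord E i u *: (tnth E i, D i)
    + \sum_i Gi i (1%g, u) *: (0, tnth E i).
  rewrite ZE; congr (_ + _); apply: eq_bigr => i _.
    by rewrite wE /complete_lift /= left_field1.
  by rewrite /vertical_lift /= left_field1.
have tE y : theta_chart c (x, y) = y.
  have := theta_chart_components hG y cx.
  by rewrite (chartK mA c1) (components_chart_at mA 1%g y) (theta1 hG).
have dT := (derive_theta_chart hG u 0 0 cx).1.
have dlin : linear (fun zeta : V * V => 'D_zeta (theta_chart c) (x, u)).
  by move=> a z1 z2; rewrite (derive_dirD _ _ dT) (derive_dirZ _ _ dT).
(* The fibre part [D i] of the complete lift is the derivative of a left-invariant field along [u],
   so [theta] sends it to minus [dtheta_chart] in the direction [u]. *)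
have e1 i : 'D_(tnth E i, D i) (theta_chart c) (x, u)
    = dtheta_chart c x (tnth E i) u - dtheta_chart c x u (tnth E i).
  rewrite (derive_theta_chart hG u _ _ cx).2; congr (_ + _).
  have := dtheta_left_field hG (tnth E i) u cx.
  rewrite {1}/local_field (chartK mA c1) left_field1 (components_chart_at mA) => ->.
  by rewrite opprK.
have e2 i : 'D_(0, tnth E i) (theta_chart c) (x, u) = tnth E i.
  rewrite (derive_theta_chart hG u _ _ cx).2 tE.
  have := @dtheta_chart_linearl c x u cx (-1) 0 0.
  by rewrite scaler0 addr0 scaleN1r addNr => ->; rewrite add0r.
rewrite ZE (derive_dirD _ _ dT) (linear_lincomb _ _ dlin) (linear_lincomb _ _ dlin).
rewrite [X in _ + X](eq_bigr (fun i => Gi i (1%g, u) *: tnth E i)); last first.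
  by move=> i _; rewrite e2.
rewrite -gE [X in X + _](_ : _ = 0) ?add0r //.
rewrite (eq_bigr (fun i => coord E i u *: dtheta_chart c x (tnth E i) u
  - coord E i u *: dtheta_chart c x u (tnth E i))); last first.
  by move=> i _; rewrite e1 scalerBr.
(* Weighted by the coordinates of [u], the frame vectors recombine to [u] in either argument, so
   both sums equal [dtheta_chart c x u u]. *)
have s1 := linear_lincomb_eq (@dtheta_chart_linearl c x u cx) (basis_coord u hE).
have s2 := linear_lincomb_eq (@dtheta_chart_linearr c x u) (basis_coord u hE).
rewrite sumrB; apply: etrans (congr2 (fun a b => a - b) s1 s2) _.
exact: subrr.
Qed.

(** [gamma] is tied to the coefficients of [Z] only over the identity, so the computation is done
    there. It is carried to [v] by translating with [v.1]: [theta] and [Z] are both invariant. *)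
Lemma derive_theta_reduced (E : n.-tuple V) (Z : G * V -> V * V) (gamma : V -> V)
    (v : G * V) :
  basis_of fullv E -> left_invariant_field A Z -> reduced_field A E Z gamma ->
  'D_(Z v) (theta_chart (chart_at A v.1)) (chart (chart_at A v.1) v.1, v.2)
  = gamma (theta A v).
Proof.
move=> hE Zinv hred; set u := theta A v.
rewrite -(derive_theta_reduced1 u hE hred).
case: v @u => p w u; set c := chart_at A p; set e := chart_at A 1%g.
have cp : dom c p := chart_at_dom mA p.
have e1 : dom e 1%g := chart_at_dom mA 1%g.
have wE : w = left_field A u p by rewrite (left_field_theta hG).
have vE : ltrans A p (1%g, u) = (p, w) by rewrite ltrans_left_field -wE.
have pe : param (e : Defs.index T) (chart e 1%g, u) = (1%g, u).
  have := tangent_chartK mA (v := (1%g, u)) e1.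
  by rewrite /= (components_chart_at mA).
have chE : chart (c : Defs.index T) (p, w) = (chart c p, w).
  by rewrite /= (components_chart_at mA).
have := Zinv p (1%g, u); rewrite /tangent_map vE => -[<-].
have := @derive_ltrans_tangent _ _ _ _ hG _ (theta A) p e c (chart e 1%g, u) (Z (1%g, u)).
rewrite pe vE /= (components_chart_at mA) (chartK mA e1) mulg1.
move=> /(_ (cod_chart e1) cp (derive_theta_chart hG w 0 0 (cod_chart cp)).1).
have -> : theta A \o ltrans A p \o param (e : Defs.index T) = theta_chart e.
  by apply/funext => z /=; rewrite (theta_ltrans hG).
by rewrite (components_chart_at mA 1%g u).
Qed.

End ReducedField.

(** * Second derivatives along varying directions *)

Section SecondDerivatives.
Context {R : realType} {n : nat}.
Local Notation V := 'rV[R]_n.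

Lemma derive_dir_lincomb (U W : normedModType R) (f : U -> W) x (I : finType)
    (a : I -> R) (s : I -> U) : differentiable f x ->
  'D_(\sum_i a i *: s i) f x = \sum_i a i *: 'D_(s i) f x.
Proof.
move=> df; rewrite derive_dir_sum //.
by apply: eq_bigr => i _; rewrite derive_dirZ.
Qed.

Lemma derive_lincomb (U W : normedModType R) (I : finType) (a : I -> U -> R^o)
    (h : I -> U -> W) x s :
  (forall i, differentiable (a i) x) -> (forall i, differentiable (h i) x) ->
  'D_s (fun t => \sum_i a i t *: h i t) x
  = \sum_i a i x *: 'D_s (h i) x + \sum_i 'D_s (a i) x *: h i x.
Proof.
move=> da dh; have dah i : differentiable (fun t => a i t *: h i t) x.
  by have [] := is_diff_scale (da i) (dh i).
rewrite (derive_sumf s dah).2 -big_split; apply: eq_bigr => i _ /=.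
exact: derive_scale.
Qed.

Lemma derive2_dir_lincomb (l : V -> R^o) (I : finType) (a : I -> R) (s : I -> V)
    u w : smooth_on setT l ->
  'D_w ('D_(\sum_i a i *: s i) l) u = \sum_i a i *: 'D_w ('D_(s i) l) u.
Proof.
move=> sl; have [dl Dl] := sl 2%N.
have ds i : differentiable ('D_(s i) l) u by exact: (Dl (s i)).1.
have -> : 'D_(\sum_i a i *: s i) l = fun t => \sum_i a i *: 'D_(s i) l t.
  by apply/funext => t; rewrite derive_dir_lincomb //; exact: dl.
have dc i : differentiable (fun=> a i : R^o) u by exact: differentiable_cst.
rewrite (derive_lincomb w dc ds) [X in _ + X]big1 ?addr0 // => i _.
by rewrite derive_cst scale0r.
Qed.

(** Direction and base point both move. In coordinates the function is a sum of products, and the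
    Leibniz rule separates the two motions. Both the Euler-Lagrange equation and the fibre Hessian
    rest on this formula. *)
Lemma derive_dir_comp (U : normedModType R) (l : V -> R^o) (a b : U -> V) t s :
  smooth_on setT l -> differentiable a t -> differentiable b t ->
  'D_s (fun t' => 'D_(a t') l (b t') : R^o) t
  = 'D_('D_s a t) l (b t) + 'D_('D_s b t) ('D_(a t) l) (b t).
Proof.
move=> sl da db; have [dl Dl] := sl 2%N.
have cr i : continuous (row_coord i : {linear V -> R^o}) by exact: row_coord_continuous.
have dr i y : differentiable (row_coord i : V -> R^o) y.
  exact: (@linear_differentiable _ _ _ (row_coord i : {linear V -> R^o})).
have dD i : differentiable ('D_(delta_mx 0 i) l) (b t) by exact: (Dl _).1.
have da' i : differentiable (row_coord i \o a : U -> R^o) t.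
  exact: differentiable_comp da (dr i _).
have db' i : differentiable ('D_(delta_mx 0 i) l \o b) t.
  exact: differentiable_comp db (dD i).
have -> : (fun t' => 'D_(a t') l (b t') : R^o) =
    fun t' => \sum_i (row_coord i \o a) t' *: ('D_(delta_mx 0 i) l \o b) t'.
  apply/funext => t'; rewrite [a t' in LHS]row_sum_delta derive_dir_lincomb //.
  exact: dl.
rewrite (derive_lincomb s da' db') addrC; congr (_ + _).
  rewrite [X in 'D_X l _]row_sum_delta derive_dir_lincomb; last exact: dl.
  apply: eq_bigr => i _.
  have -> : 'D_s (row_coord i \o a) t = row_coord i ('D_s a t).
    by rewrite (derive_comp s da (dr i _)) (derive_lin _ _ (cr i)).
  by [].
rewrite [X in _ = 'D__ ('D_X l) _]row_sum_delta (derive2_dir_lincomb _ _ _ _ sl).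
apply: eq_bigr => i _.
have -> : 'D_s ('D_(delta_mx 0 i) l \o b) t = 'D_('D_s b t) ('D_(delta_mx 0 i) l) (b t).
  exact: derive_comp s db (dD i).
by [].
Qed.

End SecondDerivatives.

(** * The two sides of the Euler-Lagrange equation for an invariant Lagrangian *)

Section EulerLagrange.
Context {R : realType} {n : nat} {G : groupTopologicalType}.
Local Notation V := 'rV[R]_n.
Context {A : atlas G V} (hG : lie_group A).
Implicit Types (c d e : Defs.index A) (p h : G) (x y z u v w : V).
Local Notation mA := (lie_group_manifold hG).
Local Notation T := (tangent_atlas A).

Lemma dtheta_chart0 c x y : cod c x -> dtheta_chart c x 0 y = 0.
Proof.
move=> cx; have := dtheta_chart_linearl hG y cx (-1) 0 0.
by rewrite scaler0 addr0 scaleN1r addNr.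
Qed.

Lemma tangent_chart_at p u :
  chart (chart_at A p : Defs.index T) (p, u) = (chart (chart_at A p) p, u).
Proof. by rewrite /= (components_chart_at mA). Qed.

Lemma theta_chart_at p u :
  theta_chart (chart_at A p) (chart (chart_at A p) p, u) = theta A (p, u).
Proof.
have ap := chart_at_dom mA p.
have := theta_chart_components hG u (cod_chart ap).
by rewrite (chartK mA ap) (components_chart_at mA p u).
Qed.

Lemma tangent_components_chart_at (v : G * V) (w : V * V) :
  components (A := T) (chart_at A v.1) v w = w.
Proof.
case: v => p u; rewrite /components /=.
set c := chart_at A p; have cp : dom c p := chart_at_dom mA p.
rewrite -[RHS](derive_id (chart (c : Defs.index T) (p, u)) w).
apply: near_eq_derive; apply: (near_open (@tangent_cod_open _ _ _ _ hG c)).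
  by apply/(tangent_codP mA); exact: cod_chart.
case=> x y /(tangent_codP mA) /= cx; rewrite (paramK mA cx).
by congr pair; exact: (vector_ofK mA).
Qed.

Section InvariantLagrangian.
Context (l : V -> R^o) (sl : smooth_on setT l).
Let L (v : G * V) : R := l (theta A v).

Lemma derive_lagrangian_chart c x y z u : cod c x ->
  'D_(z, u) (l \o theta_chart c) (x, y)
  = 'D_(dtheta_chart c x z y + theta_chart c (x, u)) l (theta_chart c (x, y)).
Proof.
move=> cx; have [dT dE] := derive_theta_chart hG y z u cx.
have [dl _] := sl 1%N.
by rewrite (derive_comp (z, u) dT (dl _ I)) dE.
Qed.

Lemma vertical_lift_lagrangian (X : G -> V) (v : G * V) :
  field_apply T (vertical_lift X) L v = 'D_(theta A (v.1, X v.1)) l (theta A v).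
Proof.
case: v => p u; have ap := chart_at_dom mA p; have cx := cod_chart ap.
rewrite /field_apply /vertical_lift.
have := @derive_lagrangian_chart (chart_at A p) _ u 0 (X p) cx.
rewrite (dtheta_chart0 _ cx) add0r (theta_chart_at p (X p)) (theta_chart_at p u) => <-.
by rewrite tangent_chart_at.
Qed.

Lemma complete_lift_lagrangian (X : G -> V) p u :
  let c := chart_at A p in let x := chart c p in
  field_apply T (complete_lift A X) L (p, u)
  = 'D_(dtheta_chart c x (X p) u + theta_chart c (x, 'D_u (local_field c X) x)) l
      (theta A (p, u)).
Proof.
move=> c x; have ap := chart_at_dom mA p; have cx := cod_chart ap.
rewrite /field_apply /complete_lift.
have := @derive_lagrangian_chart c x u (X p) ('D_u (local_field c X) x) cx.
rewrite (theta_chart_at p u) => <-.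
by rewrite tangent_chart_at.
Qed.

(** The vertical derivative is ['D_xi l] at [theta v], with xi the value of [theta] on [X]. Along
    [Z] the base point moves with velocity [u], by the second-order condition, which gives the term
    where xi varies; [theta v] moves with velocity [g], which gives the other. *)
Lemma derive_vertical_lagrangian (Z : G * V -> V * V) (X : G -> V) p u g :
  let c := chart_at A p in let x := chart c p in
  smooth_field A X -> (Z (p, u)).1 = u ->
  'D_(Z (p, u)) (theta_chart c) (x, u) = g ->
  field_apply T Z (field_apply T (vertical_lift X) L) (p, u)
  = 'D_(dtheta_chart c x u (X p) + theta_chart c (x, 'D_u (local_field c X) x)) l
      (theta A (p, u))
    + 'D_g ('D_(theta A (p, X p)) l) (theta A (p, u)).
Proof.
move=> c x sX Z1 <-; have ap : dom c p := chart_at_dom mA p; have cx := cod_chart ap.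
rewrite /field_apply -/(field_apply T (vertical_lift X) L) tangent_chart_at -/c -/x.
have [/(_ _ cx) dX _] := sX c 1%N.
have [dY YE] := derive_theta_field hG u cx dX.
have Xp : local_field c X x = X p.
  by rewrite /local_field (chartK mA ap) (components_chart_at mA).
(* The value of [theta] on [X] as a function on the tangent bundle. It depends on the base
   coordinates only, so its derivative along [Z] sees only the first component of [Z]. *)
pose a (t : V * V) := theta_chart c (t.1, local_field c X t.1).
have df : differentiable (fst : V * V -> V) (x, u).
  by apply: linear_differentiable => t; exact: cvg_fst.
have da : differentiable a (x, u) := differentiable_comp df dY.
have dT := (derive_theta_chart hG u 0 0 cx).1.
have aE : a (x, u) = theta A (p, X p) by rewrite /a /= Xp (theta_chart_at p (X p)).
have aD : 'D_(Z (p, u)) a (x, u)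
    = dtheta_chart c x u (X p) + theta_chart c (x, 'D_u (local_field c X) x).
  have -> := derive_comp (Z (p, u)) df dY.
  have cf : continuous (fst : {linear (V * V)%type -> V}) by move=> t; exact: cvg_fst.
  by rewrite (derive_lin _ _ cf) /= Z1 YE /= -/(local_field c X x) Xp.
rewrite -aE -aD -(theta_chart_at p u) -/c -/x -(derive_dir_comp _ sl da dT).
apply: near_eq_derive; apply: (near_open (@tangent_cod_open _ _ _ _ hG c)).
  exact/(tangent_codP mA).
case=> x' y' /(tangent_codP mA) /= cx'.
apply: etrans (vertical_lift_lagrangian _ _) _.
have := theta_chart_components hG (X (param c x')) cx'.
by rewrite /a /local_field /= => ->.
Qed.

End InvariantLagrangian.
End EulerLagrange.

(** * Equivalence with the Euler-Poincaré equations and with regularity on the algebra *)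

Section EulerPoincare.
Context {R : realType} {n : nat} {G : groupTopologicalType}.
Local Notation V := 'rV[R]_n.
Context {A : atlas G V} (hG : lie_group A).
Implicit Types (c d e : Defs.index A) (p h : G) (x y z u v w : V).
Local Notation mA := (lie_group_manifold hG).
Local Notation T := (tangent_atlas A).

(** The map is inverse to [theta] on the fibre over [p], which is linear. *)
Lemma left_field_linear p : linear (fun u => left_field A u p).
Proof.
move=> a u w; set X := left_field A u p; set Y := left_field A w p.
have e : theta A (p, a *: X + Y) = a *: u + w :=
  etrans (theta_linear hG p a X Y) (congr2 (fun s t => a *: s + t)
    (theta_left_field hG u p) (theta_left_field hG w p)).
by rewrite -e; exact: left_field_theta.
Qed.

Lemma scale_addB (a : R) u v u' v' :
  a *: u + v - (a *: u' + v') = a *: (u - u') + (v - v').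
Proof. by rewrite scalerBr opprD addrACA. Qed.

(* Equal to the bracket [[u, w]] of the Lie algebra, whatever [p]. *)
Definition bracket_defect p u w : V :=
  dtheta_chart (chart_at A p) (chart (chart_at A p) p) (left_field A w p) (left_field A u p)
  - dtheta_chart (chart_at A p) (chart (chart_at A p) p) (left_field A u p) (left_field A w p).

Lemma bracket_defect_linearl p w : linear (bracket_defect p ^~ w).
Proof.
have cx := cod_chart (chart_at_dom mA p).
move=> a u u'; rewrite /bracket_defect (left_field_linear p a u u').
move: (left_field A u p) (left_field A u' p) (left_field A w p) => X X' W.
exact: etrans (congr2 (fun s t => s - t) (dtheta_chart_linearr _ _ W a X X')
  (dtheta_chart_linearl hG W cx a X X')) (scale_addB _ _ _ _ _).
Qed.

Lemma bracket_defect_linearr p u : linear (bracket_defect p u).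
Proof.
have cx := cod_chart (chart_at_dom mA p).
move=> a w w'; rewrite /bracket_defect (left_field_linear p a w w').
move: (left_field A w p) (left_field A w' p) (left_field A u p) => X X' W.
exact: etrans (congr2 (fun s t => s - t) (dtheta_chart_linearl hG W cx a X X')
  (dtheta_chart_linearr _ _ W a X X')) (scale_addB _ _ _ _ _).
Qed.

Section Frame.
Context (E : n.-tuple V) (hE : basis_of fullv E).
Context (C : 'I_n -> 'I_n -> 'I_n -> R) (hC : structure_constants A E C).

(** [structure_constants] concerns the frame fields only, so [u] is first expanded in the basis by
    linearity; the Maurer-Cartan equation then applies to each pair. *)
Lemma bracket_defect_frame p u i : bracket_defect p u (tnth E i)
  = \sum_k coord E k u *: \sum_j C k i j *: tnth E j.
Proof.
rewrite -(linear_lincomb_eq (@bracket_defect_linearl p (tnth E i)) (basis_coord u hE)).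
apply: eq_bigr => k _; congr (_ *: _).
rewrite /bracket_defect (dtheta_bracket hG) hC.
rewrite (linear_lincomb _ _ (theta_linear hG p)).
by apply: eq_bigr => j _; rewrite (theta_left_field hG).
Qed.

Context (l : V -> R^o) (sl : smooth_on setT l).

Lemma derive_bracket_defect_frame p u i :
  'D_(bracket_defect p u (tnth E i)) l u
  = \sum_j \sum_k C k i j * coord E k u * 'D_(tnth E j) l u.
Proof.
have [/(_ u I) dl _] := sl 1%N.
rewrite bracket_defect_frame derive_dir_lincomb // exchange_big.
apply: eq_bigr => k _; rewrite derive_dir_lincomb // scaler_sumr.
by apply: eq_bigr => j _; rewrite scalerA [coord E k u * _]mulrC.
Qed.

Context (Gamma : G * V -> V * V) (gamma : V -> V).
Context (hsode : second_order_field A Gamma) (hinv : left_invariant_field A Gamma).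
Context (hgamma : reduced_field A E Gamma gamma).

(** The derivative of [X] along [u] enters both sides through the same vector, its image under
    [theta], and cancels. What remains depends on [X] through [X p] alone. *)
Lemma euler_lagrange_at (X : G -> V) p u : smooth_field A X ->
  field_apply T Gamma (field_apply T (vertical_lift X) (l \o theta A)) (p, u)
  = field_apply T (complete_lift A X) (l \o theta A) (p, u) <->
  'D_(gamma (theta A (p, u))) ('D_(theta A (p, X p)) l) (theta A (p, u))
  = 'D_(bracket_defect p (theta A (p, u)) (theta A (p, X p))) l (theta A (p, u)).
Proof.
move=> sX; have G1 : (Gamma (p, u)).1 = u.
  have := hsode.2 (chart_at A p) (p, u) (chart_at_dom mA p).
  by rewrite (tangent_components_chart_at hG (p, u)) (tangent_chart_at hG).
have G2 := derive_theta_reduced hG (p, u) hE hinv hgamma.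
have e1 := derive_vertical_lagrangian hG sl sX G1 G2.
have e2 := complete_lift_lagrangian hG sl X p u.
have [/(_ (theta A (p, u)) I) dl _] := sl 1%N.
(* [bracket_defect] is written with left-invariant fields; their values at [p] are here [u] and
   [X p] themselves. *)
have bE := congr2 (fun a b => dtheta_chart (chart_at A p) (chart (chart_at A p) p) b a
    - dtheta_chart (chart_at A p) (chart (chart_at A p) p) a b)
  (left_field_theta hG p u) (left_field_theta hG p (X p)).
(* Here [t] is the common vector containing the derivative of [X], and [a], [b] are the values of
   [dtheta_chart] on [u] and [X p] in the two orders. *)
have key (L1 L2 g : R^o) (a b t q r : V) : L1 = 'D_(a + t) l q + g ->
    L2 = 'D_(b + t) l q -> r = b - a -> differentiable l q ->
    L1 = L2 <-> g = 'D_r l q.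
  move=> -> -> -> d; rewrite -[b - a]addrC -scaleN1r !(derive_dirD _ _ d).
  rewrite (derive_dirZ _ _ d) scaleN1r addrAC.
  split=> [/addIr <-|->]; first by rewrite addKr.
  by rewrite addNKr.
exact: key e1 e2 bE dl.
Qed.

Lemma euler_lagrange_euler_poincare :
  euler_lagrange_field A (l \o theta A) Gamma <-> euler_poincare_field E C l gamma.
Proof.
split=> [[_ H] i u|H].
  (* Testing with the frame fields over the identity is enough, since [theta] is the identity on
     that fibre. *)
  have := (euler_lagrange_at 1%g u (left_field_smooth hG (tnth E i))).1
    (H _ (left_field_smooth hG _) _).
  by rewrite (theta_left_field hG) (theta1 hG) derive_bracket_defect_frame.
split=> // X sX [p u]; apply/euler_lagrange_at => //.
set xi := theta A (p, X p); set w := theta A (p, u).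
have [/(_ w I) dl _] := sl 1%N.
(* Both sides are linear in [xi], so the equations for the basis vectors give the one for [xi]. *)
rewrite (basis_coord xi hE) (derive2_dir_lincomb _ _ _ _ sl).
rewrite (linear_lincomb _ _ (@bracket_defect_linearr p w)) derive_dir_lincomb //.
by apply: eq_bigr => i _; rewrite derive_bracket_defect_frame H.
Qed.

Lemma hessian_lagrangian c p u : dom c p ->
  let M := \matrix_(i, k) coord E k (theta_chart c (chart c p, delta_mx 0 i)) in
  \matrix_(i < n, j < n)
    'D_(0, delta_mx 0 i) ('D_(0, delta_mx 0 j) (l \o theta_chart c))
      (chart c p, components c p u)
  = M *m (\matrix_(i < n, j < n) 'D_(tnth E i) ('D_(tnth E j) l) (theta A (p, u)))
    *m M^T.
Proof.
move=> cp M; have cx := cod_chart cp; set x := chart c p; set y := components c p u.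
have yE : theta_chart c (x, y) = theta A (p, u).
  by have := theta_chart_components hG u cx; rewrite (chartK mA cp).
apply/matrixP => i j; rewrite mxE.
pose Y (_ : V) : V := delta_mx 0 j.
pose a (t : V * V) := theta_chart c (t.1, Y t.1).
have dY0 : differentiable Y x by exact: differentiable_cst.
have dY := (derive_theta_field hG 0 cx dY0).1.
have df : differentiable (fst : V * V -> V) (x, y).
  by apply: linear_differentiable => t; exact: cvg_fst.
have da : differentiable a (x, y) := differentiable_comp df dY.
have dT := (derive_theta_chart hG y 0 0 cx).1.
have [dl Dl] := sl 2%N.
(* [a] does not vary along the fibre. This kills the first-order term in [l], which would otherwise
   spoil the congruence of the two Hessians. *)
have d0 : 'D_(0, delta_mx 0 i) a (x, y) = 0.
  have -> := derive_comp (0, delta_mx 0 i) df dY.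
  have cf : continuous (fst : {linear (V * V)%type -> V}) by move=> t; exact: cvg_fst.
  by rewrite (derive_lin _ _ cf) /= deriveE // linear0.
have tD : 'D_(0, delta_mx 0 i) (theta_chart c) (x, y) = theta_chart c (x, delta_mx 0 i).
  by rewrite (derive_theta_chart hG _ _ _ cx).2 (dtheta_chart0 hG _ cx) add0r.
have thE k : theta_chart c (x, delta_mx 0 k) = \sum_m M k m *: tnth E m.
  rewrite [LHS](basis_coord _ hE); apply: eq_bigr => m _; congr (_ *: _).
  by rewrite mxE.
have key (q r s w : V) : q = 0 -> r = \sum_m M i m *: tnth E m ->
    s = \sum_m M j m *: tnth E m -> w = theta A (p, u) ->
    'D_q l w + 'D_r ('D_s l) w = (M *m (\matrix_(i < n, j < n)
      'D_(tnth E i) ('D_(tnth E j) l) (theta A (p, u))) *m M^T) i j.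
  move=> -> -> -> ->; move: (theta A (p, u)) => th.
  rewrite (deriveE _ (dl th I)) linear0 add0r (derive2_dir_lincomb _ _ _ _ sl).
  rewrite [RHS]mxE; apply: eq_bigr => k _; rewrite [M^T _ _]mxE [RHS]mulrC.
  rewrite [(M *m _) _ _]mxE; apply: (congr1 (fun t : R => M j k * t)).
  rewrite derive_dir_lincomb; last exact: (Dl _).1.
  by apply: eq_bigr => m _; rewrite [X in _ = _ * X]mxE.
transitivity ('D_(0, delta_mx 0 i) (fun t => 'D_(a t) l (theta_chart c t) : R^o) (x, y)).
  apply: near_eq_derive; apply: (near_open (@tangent_cod_open _ _ _ _ hG c)).
    exact/(tangent_codP mA).
  case=> x' y' /(tangent_codP mA) /= cx'.
  rewrite (derive_lagrangian_chart hG sl y' 0 _ cx').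
  by rewrite (dtheta_chart0 hG _ cx') add0r.
apply: etrans (derive_dir_comp (0, delta_mx 0 i) sl da dT) _.
exact: key d0 (etrans tD (thE i)) (thE j) yE.
Qed.

Lemma theta_matrix_unit c p : dom c p ->
  \matrix_(i < n, k < n) coord E k (theta_chart c (chart c p, delta_mx 0 i)) \in unitmx.
Proof.
move=> cp; have cx := cod_chart cp; set M := \matrix_(_, _) _.
(* The rows of [N] are the components of the left-invariant frame in the chart [c]. As [theta] sends
   the frame back to [E], this is the inverse of [M]. *)
pose N := \matrix_(k < n, j < n)
  row_coord j (local_field c (left_field A (tnth E k)) (chart c p)).
suff /mulmx1_unit[] : N *m M = 1%:M by [].
apply/matrixP => k m; rewrite mxE [RHS]mxE.
pose Y := local_field c (left_field A (tnth E k)) (chart c p).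
transitivity (coord E m (tnth E k)); last first.
  by rewrite (tnth_nth 0) coord_free // (basis_free hE).
rewrite -[tnth E k in RHS](theta_local_left_field hG _ cx) -/Y.
have -> : theta_chart c (chart c p, Y)
    = \sum_j row_coord j Y *: theta_chart c (chart c p, delta_mx 0 j).
  rewrite (theta_chartE hG _ cx); apply: eq_bigr => j _; congr (_ *: _).
  rewrite (theta_chartE hG _ cx) (bigD1 j) //= big1 ?addr0 => [|j' jj'].
    by rewrite /row_coord mxE !eqxx scale1r.
  by rewrite /row_coord mxE eqxx (negPf jj') scale0r.
rewrite linear_sum; apply: eq_bigr => j _; rewrite linearZ.
by congr (_ * _); rewrite mxE.
Qed.

Lemma regular_lagrangian_algebra :
  regular_lagrangian A (l \o theta A) <-> regular_on_algebra E l.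
Proof.
have key c p u : dom c p -> (\matrix_(i < n, j < n)
      'D_(0, delta_mx 0 i) ('D_(0, delta_mx 0 j) (l \o theta_chart c))
        (chart c p, components c p u) \in unitmx)
    = (\matrix_(i < n, j < n) 'D_(tnth E i) ('D_(tnth E j) l) (theta A (p, u))
        \in unitmx).
  move=> cp.
  apply: etrans (congr1 (fun Q : 'M[R]_n => Q \in unitmx) (hessian_lagrangian u cp)) _.
  rewrite !unitmx_mul unitmx_tr.
  by rewrite theta_matrix_unit // andbT.
split=> H.
  (* Every element of the algebra is the value of [theta] on a vector over the identity, so a single
     fibre covers all [u]. *)
  move=> u; have c1 := chart_at_dom mA 1%g.
  rewrite -(theta1 hG u).
  apply: etrans (esym (key (chart_at A 1%g) 1%g u c1)) _.
  exact: H (chart_at A 1%g) (1%g, u) c1.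
move=> c [p u] cp; have h := etrans (key c p u cp) (H (theta A (p, u))).
exact: h.
Qed.

End Frame.
End EulerPoincare.

(** * Passage between Lagrangians on the tangent bundle and on the algebra *)

Theorem theorem2 (R : realType) (n : nat) (G : groupTopologicalType)
    (A : atlas G 'rV[R]_n) (hG : lie_group A) (hconn : connected [set: G])
    (E : n.-tuple 'rV[R]_n) (hE : basis_of fullv E)
    (C : 'I_n -> 'I_n -> 'I_n -> R) (hC : structure_constants A E C)
    (Gamma : G * 'rV[R]_n -> 'rV[R]_n * 'rV[R]_n)
    (hsode : second_order_field A Gamma)
    (hinv : left_invariant_field A Gamma)
    (gamma : 'rV[R]_n -> 'rV[R]_n) (hgamma : reduced_field A E Gamma gamma) :
  (exists L : G * 'rV[R]_n -> R,
     [/\ smooth_fun (tangent_atlas A) L,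
         left_invariant_fun A L,
         regular_lagrangian A L &
         euler_lagrange_field A L Gamma]) <->
  (exists l : 'rV[R]_n -> R,
     [/\ smooth_on [set: 'rV[R]_n] (l : 'rV[R]_n -> R^o),
         regular_on_algebra E l &
         euler_poincare_field E C l gamma]).
Proof.
have mA := lie_group_manifold hG.
split=> [[L [sL invL rL eL]]|[l [sl rl el]]].
  pose l : 'rV[R]_n -> R^o := fun u => L (1%g, u).
  have LE : L = l \o theta A.
    by apply/funext => v; rewrite -(invL v.1^-1%g v) ltrans_theta.
  have c1 := chart_at_dom mA 1%g; set c := chart_at A 1%g in c1.
  have cx := cod_chart c1.
  have sl : smooth_on setT l.
    (* [f] is the inclusion of the fibre over the identity, read in the induced chart; [l] is the
       local expression of [L] composed with it. *)
    move=> k; pose f (u : 'rV[R]_n) := (chart c 1%g, u).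
    have cf : classC k setT f.
      by apply: classC_pair; [exact: openT|exact: classC_cst|exact: classC_id].
    have := classC_comp (finite_dim_prod (finite_dim_rV n) (finite_dim_rV n))
      (@openT _) _ cf (sL c k).
    have -> : (L \o param (c : Defs.index (tangent_atlas A))) \o f = l.
      apply/funext => u; have := tangent_chartK mA (v := (1%g, u)) c1.
      by rewrite (tangent_chart_at hG 1%g u) /l => <-.
    by apply=> u _; apply/(tangent_codP mA).
  rewrite LE in rL eL.
  exists l; split=> //; first exact/(regular_lagrangian_algebra hG hE sl).
  exact/(euler_lagrange_euler_poincare hG hE hC sl hsode hinv hgamma).
exists (l \o theta A); split.
- move=> c k; exact: (classC_comp (finite_dim_rV n) (@tangent_cod_open _ _ _ _ hG c)
    (fun _ _ => I) (@theta_chart_smooth _ _ _ _ hG c k) (sl k)).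
- by move=> h v; rewrite /= (theta_ltrans hG).
- exact/(regular_lagrangian_algebra hG hE sl).
- exact/(euler_lagrange_euler_poincare hG hE hC sl hsode hinv hgamma).
Qed.
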